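(* Let $N\ge 1$ and let $(A_k)_{k\in\mathbb{Z}}$ be a sequence of invertible matrices in $\mathbb{R}^{N\times N}$; consider the system $x_{k+1}=A_kx_k$, $k\in\mathbb{Z}$. Its nonuniform dichotomy spectrum $\Sigma_{NED}(A)\subset\mathbb{R}^+=(0,\infty)$ is the disjoint union of $n$ closed intervals (called spectral intervals), where $0\le n\le N$; that is, $\Sigma_{NED}(A)=\emptyset$ (case $n=0$), or $\Sigma_{NED}(A)=\mathbb{R}^+$, or $\Sigma_{NED}(A)$ has one of the four forms $$\Sigma_{NED}(A)=\left\{\begin{matrix}[a_1,b_1]\\ \text{or}\\ (0,b_1]\end{matrix}\right\}\cup[a_2,b_2]\cup\cdots\cup[a_{n-1},b_{n-1}]\cup\left\{\begin{matrix}[a_n,b_n]\\ \text{or}\\ [a_n,\infty)\end{matrix}\right\},$$ where $0<a_1\le b_1<a_2\le b_2<\cdots<a_n\le b_n$. Choose, if possible, (i) $\gamma_0\in\rho_{NED}(A)$ with $(0,\gamma_0)\subset\rho_{NED}(A)$; otherwise define $\mathcal{U}_{\gamma_0}:=\mathbb{Z}\times\mathbb{R}^N$ and $\mathcal{S}_{\gamma_0}:=\mathbb{Z}\times\{0\}$. Choose, if possible, (ii) $\gamma_n\in\rho_{NED}(A)$ with $(\gamma_n,+\infty)\subset\rho_{NED}(A)$; otherwise define $\mathcal{U}_{\gamma_n}:=\mathbb{Z}\times\{0\}$ and $\mathcal{S}_{\gamma_n}:=\mathbb{Z}\times\mathbb{R}^N$. (If $n=0$, one and the same $\gamma_0$ is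 used.) Then the sets $$\mathcal{W}_0=\mathcal{S}_{\gamma_0}\quad\text{and}\quad\mathcal{W}_{n+1}=\mathcal{U}_{\gamma_n}$$ are invariant vector bundles of $x_{k+1}=A_kx_k$. For $n\ge2$ choose (iii) $\gamma_i\in\rho_{NED}(A)$ with $b_i<\gamma_i<a_{i+1}$ for $i=1,\dots,n-1$. Then for every $i=1,\dots,n$ the intersection $$\mathcal{W}_i=\mathcal{U}_{\gamma_{i-1}}\cap\mathcal{S}_{\gamma_i}$$ is an invariant vector bundle of $x_{k+1}=A_kx_k$ with $\dim\mathcal{W}_i\ge1$. The invariant vector bundles $\mathcal{W}_i$, $i=0,\dots,n+1$ (called spectral bundles), are independent of the choice of $\gamma_0,\dots,\gamma_n$ in (i), (ii), (iii). Moreover $$\mathcal{W}_0\oplus\cdots\oplus\mathcal{W}_{n+1}=\mathbb{Z}\times\mathbb{R}^N$$ is a Whitney sum, i.e. $\mathcal{W}_i\cap\mathcal{W}_j=\mathbb{Z}\times\{0\}$ for $i\ne j$ and $\mathcal{W}_0+\cdots+\mathcal{W}_{n+1}=\mathbb{Z}\times\mathbb{R}^N$ (sums taken fiberwise).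
   Context: Norms: $\|\cdot\|$ is a fixed norm on $\mathbb{R}^N$ and the induced matrix norm. Evolution operator of $x_{k+1}=A_kx_k$: $\Phi(k,l)=A_{k-1}\cdots A_l$ for $k>l$, $\Phi(k,k)=\mathrm{Id}$, $\Phi(k,l)=A_k^{-1}\cdots A_{l-1}^{-1}$ for $k<l$ ($k,l\in\mathbb{Z}$). An invariant projector is a family of projections $P_k\in\mathbb{R}^{N\times N}$ ($k\in\mathbb{Z}$) with $P_{k+1}A_k=A_kP_k$ for all $k\in\mathbb{Z}$; put $Q_k=\mathrm{Id}-P_k$. The system admits a nonuniform exponential dichotomy if there are an invariant projector $P$ and constants $0<\alpha<1$, $K\ge1$, $\varepsilon\ge1$ such that $\|\Phi(k,l)P_l\|\le K\alpha^{k-l}\varepsilon^{l}$ for $k\ge l$ and $\|\Phi(k,l)Q_l\|\le K(\tfrac1\alpha)^{k-l}\varepsilon^{l}$ for $k\le l$ ($k,l\in\mathbb{Z}$). It is a strong nonuniform exponential dichotomy if in addition $\alpha\varepsilon^2<1$. For $\gamma\in\mathbb{R}^+$ the weighted system is $x_{k+1}=\tfrac1\gamma A_kx_k$, with evolution operator $\Phi_\gamma(k,l)=(\tfrac1\gamma)^{k-l}\Phi(k,l)$. The nonuniform dichotomy spectrum $\Sigma_{NED}(A)$ is the set of $\gamma\in\mathbb{R}^+$ for which the weighted system admits no strong nonuniform exponential dichotomy, and $\rho_{NED}(A)=\mathbb{R}^+\setminus\Sigma_{NED}(A)$. For $\gamma\in\rho_{NED}(A)$, with $\varepsilon$ the constant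 in the strong nonuniform exponential dichotomy of the weighted system, $\mathcal{S}_\gamma=\{(l,\xi)\in\mathbb{Z}\times\mathbb{R}^N:\sup_{k\ge l}\|\Phi(k,l)\xi\|\gamma^{-k}\varepsilon^{-l}<\infty\}$, $\mathcal{U}_\gamma=\{(l,\xi)\in\mathbb{Z}\times\mathbb{R}^N:\sup_{k\le l}\|\Phi(k,l)\xi\|\gamma^{-k}\varepsilon^{-l}<\infty\}$ (these sets do not depend on the choice of $\varepsilon$). A nonempty set $\mathcal{W}\subset\mathbb{Z}\times\mathbb{R}^N$ is an invariant vector bundle of $x_{k+1}=A_kx_k$ if (a) $(l,\xi)\in\mathcal{W}$ implies $(k,\Phi(k,l)\xi)\in\mathcal{W}$ for all $k\in\mathbb{Z}$, and (b) for every $l\in\mathbb{Z}$ the fiber $\mathcal{W}(l)=\{\xi\in\mathbb{R}^N:(l,\xi)\in\mathcal{W}\}$ is a linear subspace of $\mathbb{R}^N$. Its dimension $\dim\mathcal{W}$ is the (constant in $l$) dimension of the fibers. *)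

(* Defs.v *)
From HB Require Import structures.
From mathcomp Require Export all_boot all_order all_algebra.
From mathcomp Require Export all_classical all_reals all_analysis.

Set Implicit Arguments.
Unset Strict Implicit.
Unset Printing Implicit Defensive.

Import Order.TTheory GRing.Theory Num.Theory.
Local Open Scope classical_set_scope.
Local Open Scope ring_scope.

Definition is_norm (R : realType) (N : nat) (nrm : 'cV[R]_N -> R) : Prop :=
  [/\ forall x y, nrm (x + y) <= nrm x + nrm y,
      forall (c : R) x, nrm (c *: x) = `|c| * nrm x &
      forall x, nrm x = 0 -> x = 0].

Definition op_norm (R : realType) (N : nat) (nrm : 'cV[R]_N -> R)
    (M : 'M[R]_N) : R :=
  sup [set nrm (M *m x) | x in [set x | nrm x <= 1]].

(* [\big[mulmx/1%:M]_(i < n) F i] is F 0 *m F 1 *m ... *m F n.-1. *)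
Definition evol (R : realType) (N : nat) (A : int -> 'M[R]_N) (k l : int) :
    'M[R]_N :=
  if l <= k then \big[@mulmx R N N N/1%:M]_(i < `|k - l|%N) A (k - 1 - i%:Z)
  else \big[@mulmx R N N N/1%:M]_(i < `|l - k|%N) invmx (A (k + i%:Z)).

Definition invariant_projector (R : realType) (N : nat)
    (A P : int -> 'M[R]_N) : Prop :=
  (forall k, P k *m P k = P k) /\ (forall k, P (k + 1) *m A k = A k *m P k).

(* [alpha ^ m] is the power with exponent [m : int]. *)
Definition is_NED (R : realType) (N : nat) (nrm : 'cV[R]_N -> R)
    (A P : int -> 'M[R]_N) (alpha K eps : R) : Prop :=
  [/\ invariant_projector A P, 0 < alpha < 1, 1 <= K & 1 <= eps] /\
  (forall k l : int, l <= k ->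
     op_norm nrm (evol A k l *m P l) <= K * alpha ^ (k - l) * eps ^ l) /\
  (forall k l : int, k <= l ->
     op_norm nrm (evol A k l *m (1%:M - P l))
       <= K * (1 / alpha) ^ (k - l) * eps ^ l).

Definition strong_NED (R : realType) (N : nat) (nrm : 'cV[R]_N -> R)
    (A : int -> 'M[R]_N) (eps : R) : Prop :=
  exists (P : int -> 'M[R]_N) (alpha K : R),
    is_NED nrm A P alpha K eps /\ alpha * eps ^+ 2 < 1.

Definition weighted (R : realType) (N : nat) (g : R) (A : int -> 'M[R]_N) :
    int -> 'M[R]_N :=
  fun k => (1 / g) *: A k.

Definition ned_spectrum (R : realType) (N : nat) (nrm : 'cV[R]_N -> R)
    (A : int -> 'M[R]_N) : set R :=
  [set g | 0 < g /\ ~ exists eps, strong_NED nrm (weighted g A) eps].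

Definition ned_resolvent (R : realType) (N : nat) (nrm : 'cV[R]_N -> R)
    (A : int -> 'M[R]_N) : set R :=
  [set g | 0 < g] `\` ned_spectrum nrm A.

(* The constant [eps] of the dichotomy of the weighted system is an explicit
   parameter of the next two sets. *)
Definition stable_bundle (R : realType) (N : nat) (nrm : 'cV[R]_N -> R)
    (A : int -> 'M[R]_N) (g eps : R) : set (int * 'cV[R]_N) :=
  [set p | (ereal_sup [set (nrm (evol A k p.1 *m p.2) * g ^ (- k)
                             * eps ^ (- p.1))%:E
                      | k in [set k : int | (p.1 <= k)%R]] < +oo)%E].

Definition unstable_bundle (R : realType) (N : nat) (nrm : 'cV[R]_N -> R)
    (A : int -> 'M[R]_N) (g eps : R) : set (int * 'cV[R]_N) :=
  [set p | (ereal_sup [set (nrm (evol A k p.1 *m p.2) * g ^ (- k)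
                             * eps ^ (- p.1))%:E
                      | k in [set k : int | (k <= p.1)%R]] < +oo)%E].

Definition fiber (R : realType) (N : nat) (W : set (int * 'cV[R]_N))
    (l : int) : set 'cV[R]_N :=
  [set x | W (l, x)].

Definition invariant_bundle (R : realType) (N : nat) (A : int -> 'M[R]_N)
    (W : set (int * 'cV[R]_N)) : Prop :=
  [/\ W !=set0,
      forall l x, W (l, x) -> forall k, W (k, evol A k l *m x) &
      forall l, exists V : {vspace 'cV[R]_N},
        fiber W l = [set x | x \in V]].

Definition bundle_dim (R : realType) (N : nat) (W : set (int * 'cV[R]_N))
    (d : nat) : Prop :=
  forall l, exists V : {vspace 'cV[R]_N},
    fiber W l = [set x | x \in V] /\ \dim V = d.

Definition zero_bundle (R : realType) (N : nat) : set (int * 'cV[R]_N) :=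
  [set p | p.2 = 0].
Arguments zero_bundle : clear implicits.

Definition bundle_sum (R : realType) (N m : nat)
    (W : nat -> set (int * 'cV[R]_N)) : set (int * 'cV[R]_N) :=
  [set p | exists w : nat -> 'cV[R]_N,
     (forall i, (i < m)%N -> W i (p.1, w i)) /\ p.2 = \sum_(i < m) w i].

(* For 1 <= i <= n this is [a i, b i], except that the lower end of the first
   interval is (0 when [zl] holds, and the last interval is unbounded when [zr]
   holds; n = 1 with both gives (0, +oo). *)
Definition spectral_interval (R : realType) (n : nat) (zl zr : bool)
    (a b : nat -> R) (i : nat) : interval R :=
  Interval (if (i == 1)%N && zl then BRight 0 else BLeft (a i))
           (if (i == n)%N && zr then +oo%O else BRight (b i)).

Definition spectral_form (R : realType) (n : nat) (zl zr : bool)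
    (a b : nat -> R) (Sigma : set R) : Prop :=
  [/\ forall i, (1 <= i <= n)%N -> 0 < a i <= b i,
      forall i, (1 <= i < n)%N -> b i < a i.+1 &
      Sigma = \bigcup_(i in [set i | (1 <= i <= n)%N])
                [set` spectral_interval n zl zr a b i]].

Definition low_gap (R : realType) (N : nat) (nrm : 'cV[R]_N -> R)
    (A : int -> 'M[R]_N) (g : R) : Prop :=
  ned_resolvent nrm A g /\
  forall x, 0 < x < g -> ned_resolvent nrm A x.

Definition high_gap (R : realType) (N : nat) (nrm : 'cV[R]_N -> R)
    (A : int -> 'M[R]_N) (g : R) : Prop :=
  ned_resolvent nrm A g /\
  forall x, g < x -> ned_resolvent nrm A x.

(* [g i], 0 <= i <= n, are the chosen resolvent points and [e i] is a constant
   of a strong dichotomy for the weight [g i].  The value [g 0] (resp. [g n])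
   is unconstrained when no suitable point exists, as it is then not used in
   [chosen_stable] and [chosen_unstable].  If n = 0, [g 0] meets both end
   conditions. *)
Definition gap_choice (R : realType) (N : nat) (nrm : 'cV[R]_N -> R)
    (A : int -> 'M[R]_N) (n : nat) (a b g e : nat -> R) : Prop :=
  [/\ (exists x, low_gap nrm A x) ->
        low_gap nrm A (g 0) /\ strong_NED nrm (weighted (g 0) A) (e 0),
      (exists x, high_gap nrm A x) ->
        high_gap nrm A (g n) /\ strong_NED nrm (weighted (g n) A) (e n) &
      forall i, (1 <= i < n)%N ->
        [/\ ned_resolvent nrm A (g i), b i < g i < a i.+1 &
            strong_NED nrm (weighted (g i) A) (e i)]].

Definition chosen_stable (R : realType) (N : nat) (nrm : 'cV[R]_N -> R)
    (A : int -> 'M[R]_N) (n : nat) (g e : nat -> R) (i : nat) :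
    set (int * 'cV[R]_N) :=
  if (i == 0)%N && ~~ `[< exists x, low_gap nrm A x >] then zero_bundle R N
  else if (i == n)%N && ~~ `[< exists x, high_gap nrm A x >] then setT
  else stable_bundle nrm A (g i) (e i).

Definition chosen_unstable (R : realType) (N : nat) (nrm : 'cV[R]_N -> R)
    (A : int -> 'M[R]_N) (n : nat) (g e : nat -> R) (i : nat) :
    set (int * 'cV[R]_N) :=
  if (i == 0)%N && ~~ `[< exists x, low_gap nrm A x >] then setT
  else if (i == n)%N && ~~ `[< exists x, high_gap nrm A x >]
       then zero_bundle R N
  else unstable_bundle nrm A (g i) (e i).

Definition spectral_bundle (R : realType) (N : nat) (nrm : 'cV[R]_N -> R)
    (A : int -> 'M[R]_N) (n : nat) (g e : nat -> R) (i : nat) :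
    set (int * 'cV[R]_N) :=
  if (i == 0)%N then chosen_stable nrm A n g e 0
  else if (i == n.+1)%N then chosen_unstable nrm A n g e n
  else chosen_unstable nrm A n g e i.-1 `&` chosen_stable nrm A n g e i.

(* Main.v *)
Require Import Defs.
From mathcomp Require Import ring lra zify.

(** The estimates of a strong nonuniform dichotomy contain the factor eps ^ l for
    all integers l, also for l tending to minus infinity.  Taken at k = l they
    bound the norms of P_l and Id - P_l by K * eps ^ l, so that eps > 1 would make
    both projections vanish for some l; hence eps = 1 ([strong_NED_eps1]) and the
    dichotomies of the theorem are uniform.

    Moving the weight into the rate of growth, the weight g has a dichotomy with
    projector P iff P has the stable estimate with some rate b < g and Id - P the
    unstable estimate with some rate b > g ([dichotomy]).  The first condition
    survives when g increases, the second when g decreases, and both survive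
    small changes of g.  Moreover the bundles of weight g are the range and the
    kernel of P ([stable_bundleE], [unstable_bundleE]).  Three facts follow.
    - For g <= g' the projectors satisfy P P' = P' P = P ([dichotomy_le]), so the
      rank increases with g, and equal ranks mean equal projectors.
    - If g < g' carry the same projector, so does every weight in between: points
      of the resolvent set of equal rank are not separated by the spectrum.
    - Along a segment in the resolvent set the projector is locally constant,
      hence constant ([dichotomy_segment]): points of different rank are
      separated by the spectrum ([gap_separated]).

    A missing end gap is treated as a virtual gap point: 0 with projector 0, or
    +oo with projector Id ([gap]).  The three facts still hold, and every spectral
    point has gap points on both sides.  The resolvent set thus falls into open
    intervals labelled by ranks s 0 < ... < s n in {0, ..., N}, virtual ones
    included, so that n <= N; the spectrum consists of the n closed intervals
    between consecutive labels ([level_decomposition]).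

    Whatever gap points are chosen, the bundles at position i are the range and
    the kernel of the one projector P_i of rank s i; this gives independence of
    the choice.  With 0 in front and Id at the end, the P_i form a flag of
    commuting projectors, and the spectral bundles are the ranges of its
    successive differences.  These telescope to Id, annihilate each other, and
    those between consecutive P_i are nonzero because the ranks differ. *)

Set Implicit Arguments.
Unset Strict Implicit.
Unset Printing Implicit Defensive.

Import Order.TTheory GRing.Theory Num.Theory.
Import numFieldNormedType.Exports.
Local Open Scope classical_set_scope.
Local Open Scope ring_scope.

(** * Norms on a finite-dimensional space *)

Section Norm.
Variables (R : realType) (N : nat) (nrm : 'cV[R]_N -> R).
Hypothesis hnrm : is_norm nrm.

Lemma is_norm0 : nrm 0 = 0.
Proof. by case: hnrm => _ hZ _; rewrite -(scale0r 0) hZ normr0 mul0r. Qed.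

Lemma is_normN x : nrm (- x) = nrm x.
Proof. by case: hnrm => _ hZ _; rewrite -scaleN1r hZ normrN1 mul1r. Qed.

Lemma is_norm_ge0 x : 0 <= nrm x.
Proof.
case: hnrm => hD _ _; have := hD x (- x).
by rewrite subrr is_norm0 is_normN; lra.
Qed.

Lemma is_norm_sum (I : Type) (r : seq I) (F : I -> 'cV[R]_N) :
  nrm (\sum_(i <- r) F i) <= \sum_(i <- r) nrm (F i).
Proof.
case: hnrm => hD _ _.
elim: r => [|i r IH]; first by rewrite !big_nil is_norm0.
by rewrite !big_cons; apply: le_trans (hD _ _) _; rewrite lerD2l.
Qed.

Lemma mx_entry_le_norm (v : 'rV[R]_N) i : `|v 0 i| <= `|v|.
Proof.
rewrite [leRHS]/Num.norm /= mx_normrE.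
by apply: (le_bigmax _ (fun i => `|v i.1 i.2|) (ord0, i)).
Qed.

Lemma is_norm_mulmx_le (M : 'M[R]_N) (v : 'rV[R]_N) :
  nrm (M *m v^T) <= (\sum_i nrm (col i M)) * `|v|.
Proof.
have -> : M *m v^T = \sum_i v 0 i *: col i M.
  apply/colP => j; rewrite !mxE summxE; apply: eq_bigr => i _.
  by rewrite !mxE mulrC.
apply: le_trans (is_norm_sum _ _) _.
rewrite mulr_suml; apply: ler_sum => i _.
case: hnrm => _ -> _; rewrite mulrC.
by apply: ler_wpM2l; [exact: is_norm_ge0|exact: mx_entry_le_norm].
Qed.

(** On a finite-dimensional space every norm dominates the maximum norm: the
    norm is continuous, so it attains a minimum on the compact unit sphere of
    the maximum norm, and this minimum is not zero. *)
Lemma max_norm_le : exists2 c, 0 < c & forall v : 'rV[R]_N, c * `|v| <= nrm v^T.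
Proof.
pose f (v : 'rV[R]_N) := nrm v^T.
pose S : set 'rV[R]_N := [set v | `|v| = 1].
pose C := \sum_i nrm (col i (1%:M : 'M[R]_N)).
have C0 : 0 <= C by apply: sumr_ge0 => i _; exact: is_norm_ge0.
have fC v : f v <= C * `|v| by rewrite /f -[v^T]mul1mx is_norm_mulmx_le.
have fL v w : `|f v - f w| <= C * `|v - w|.
  case: hnrm => hD _ _; rewrite ler_norml; apply/andP; split.
    have := hD v^T (w - v)^T; rewrite -linearD /= addrC subrK -/(f w) -/(f v).
    by rewrite distrC; have := fC (w - v); rewrite /f; lra.
  have := hD w^T (v - w)^T; rewrite -linearD /= addrC subrK -/(f w) -/(f v).
  by have := fC (v - w); rewrite /f; lra.
have fcont : continuous f.
  move=> v; apply/(cvgrPdist_lt (FF := nbhs_filter v)) => e e0.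
  have C1 : 0 < C + 1 by lra.
  have e1 : 0 < (C + 1)^-1 * e by rewrite mulr_gt0 ?invr_gt0.
  have : \forall w \near nbhs v, `|v - w| < (C + 1)^-1 * e.
    by apply/nbhs_ballP; exists ((C + 1)^-1 * e) => //= w; rewrite mx_norm_ball.
  apply: filterS => w vw; apply: le_lt_trans (fL _ _) _.
  apply: (@le_lt_trans _ _ ((C + 1) * `|v - w|)).
    by apply: ler_wpM2r => //; lra.
  by rewrite -ltr_pdivlMl.
have [S0|/nonemptyPn S0] := pselect (S !=set0); last first.
  exists 1 => // v; have [->|v0] := eqVneq v 0.
    by rewrite normr0 mulr0 is_norm_ge0.
  have : S (`|v|^-1 *: v).
    by rewrite /S /= normrZ normfV normr_id mulVf// normr_eq0.
  by rewrite S0.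
have Sc : compact S.
  apply: bounded_closed_compact.
    exists 1; split => // M M1 v /= ->; exact: ltW.
  apply: (@preimage_closed _ R^o (fun v : 'rV[R]_N => `|v|) [set 1%R]) => //.
    by move=> v _; exact: norm_continuous.
have [v /set_mem vS vmin] := EVT_min_rV S0 Sc (continuous_subspaceT fcont).
exists (f v).
  rewrite lt0r /f is_norm_ge0 andbT; apply/eqP; case: hnrm => _ _ h /h vT0.
  have v0 : v = 0 by rewrite -[v]trmxK vT0 trmx0.
  by move: vS; rewrite /S /= v0 normr0 => /esym/eqP; rewrite oner_eq0.
move=> w; have [->|w0] := eqVneq w 0.
  by rewrite normr0 mulr0 is_norm_ge0.
have w1 : 0 < `|w| by rewrite normr_gt0.
have : f v <= f (`|w|^-1 *: w).
  apply: vmin; apply/mem_set.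
  by rewrite /S /= normrZ normfV normr_id mulVf// normr_eq0.
case: hnrm => _ hZ _.
rewrite /f [X in _ <= nrm X]linearZ /= hZ normfV normr_id.
by rewrite -ler_pdivlMr// mulrC.
Qed.

(** A supremum over an unbounded set is 0 by convention, so the operator norm
    controls the matrix only because [max_norm_le] makes that set bounded. *)
Lemma op_norm_bound (M : 'M[R]_N) x : nrm (M *m x) <= op_norm nrm M * nrm x.
Proof.
have [c c0 hc] := max_norm_le.
pose C := \sum_i nrm (col i M).
have C0 : 0 <= C by apply: sumr_ge0 => i _; exact: is_norm_ge0.
have ub y : nrm y <= 1 -> nrm (M *m y) <= C * c^-1.
  move=> y1; rewrite -[y]trmxK; apply: le_trans (is_norm_mulmx_le _ _) _.
  apply: ler_wpM2l => //; rewrite -(ler_pM2l c0) mulfV ?gt_eqF//.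
  by apply: le_trans (hc _) _; rewrite trmxK.
have hs : has_sup [set nrm (M *m x) | x in [set x | nrm x <= 1]].
  split; first by exists (nrm (M *m 0)); exists 0 => //=; rewrite is_norm0.
  by exists (C * c^-1) => _ [y y1 <-]; exact: ub.
case: (hnrm) => _ hZ h0.
have [x0|x0] := eqVneq (nrm x) 0.
  by rewrite (h0 _ x0) mulmx0 is_norm0 mulr0.
have xp : 0 < nrm x by rewrite lt0r x0 is_norm_ge0.
rewrite -ler_pdivrMr//; apply: (sup_upper_bound hs).
exists ((nrm x)^-1 *: x) => /=.
  by rewrite hZ normfV ger0_norm ?is_norm_ge0// mulVf.
by rewrite -scalemxAr hZ normfV ger0_norm ?is_norm_ge0// mulrC.
Qed.

Lemma op_norm_le (M : 'M[R]_N) C : 0 <= C ->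
  (forall x, nrm (M *m x) <= C * nrm x) -> op_norm nrm M <= C.
Proof.
move=> C0 h; apply: ge_sup.
  by exists (nrm (M *m 0)); exists 0 => //=; rewrite is_norm0.
move=> _ [y /= y1 <-]; apply: le_trans (h _) _.
by rewrite -[leRHS]mulr1; exact: ler_wpM2l.
Qed.

End Norm.

(** * Evolution operators and invariant projectors *)

(** The step is an equivalence so that one proof covers both directions of time:
    invertible coefficients let every identity between solutions go back as well. *)
Lemma int_shift_ind (P : int -> Prop) (l : int) :
  P l -> (forall k, P k <-> P (k + 1)) -> forall k, P k.
Proof.
move=> Pl PS k; rewrite -[k](subrK l) addrC.
case: (k - l) => n.
  elim: n => [|n IH]; first by rewrite addr0.
  have -> : l + n.+1%:Z = l + n%:Z + 1 by lia.
  exact: (PS _).1.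
elim: n => [|n IH]; apply: (PS _).2.
  by rewrite NegzE addrNK.
by suff -> : l + Negz n.+1 + 1 = l + Negz n by []; lia.
Qed.

Section Matrices.
Variables (R : realType) (N : nat).

Lemma mulmx_cV_inj (p q : 'M[R]_N) : (forall x : 'cV[R]_N, p *m x = q *m x) -> p = q.
Proof.
move=> h; apply/matrixP => i j; have := h (delta_mx j 0).
by rewrite -!colE => /colP/(_ i); rewrite !mxE.
Qed.

Lemma idmx_neq0 : (0 < N)%N -> (1%:M : 'M[R]_N) <> 0.
Proof.
move=> N0 /matrixP/(_ (Ordinal N0) (Ordinal N0)).
by rewrite !mxE eqxx /= => /eqP; rewrite oner_eq0.
Qed.

End Matrices.

Section Evolution.
Variables (R : realType) (N : nat).
Implicit Types (A P : int -> 'M[R]_N).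

Lemma evol_id A k : evol A k k = 1%:M.
Proof. by rewrite /evol lexx subrr big_ord0. Qed.

(** One recursion for both branches of [evol]; with [int_shift_ind] it replaces
    every further use of the products. *)
Lemma evolS A k l : (forall k, A k \in unitmx) ->
  evol A (k + 1) l = A k *m evol A k l.
Proof.
move=> hA; rewrite /evol; case: (leP l k) => lk.
  have -> : l <= k + 1 by lia.
  have -> : `|(k + 1 - l)%R|%N = `|k - l|%N.+1 by lia.
  rewrite big_ord_recl; congr (A _ *m _); first by rewrite /= subr0 addrK.
  by apply: eq_bigr => i _; congr (A _); rewrite /= /bump /=; lia.
have -> : `|l - k|%N = `|(l - (k + 1))%R|%N.+1 by lia.
rewrite big_ord_recl addr0 mulKVmx//.
have [e|e] := eqVneq l (k + 1).
  by rewrite e lexx subrr !big_ord0.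
have -> : (l <= k + 1) = false by lia.
by apply: eq_bigr => i _; congr (invmx (A _)); rewrite /= /bump /= add1n intS addrA.
Qed.

Lemma evol_comp A k m l : (forall k, A k \in unitmx) ->
  evol A k m *m evol A m l = evol A k l.
Proof.
move=> hA; move: k; apply: (@int_shift_ind _ m); first by rewrite evol_id mul1mx.
move=> k; rewrite !evolS// -mulmxA; split=> [->//|].
by move/(congr1 (mulmx (invmx (A k)))); rewrite !mulKmx.
Qed.

Lemma evolK A k l : (forall k, A k \in unitmx) ->
  evol A l k *m evol A k l = 1%:M.
Proof. by move=> hA; rewrite evol_comp// evol_id. Qed.

Lemma weighted_unit A g k : 0 < g -> A k \in unitmx ->
  weighted g A k \in unitmx.
Proof. by move=> g0; rewrite /weighted unitmxZ// unitfE div1r invr_eq0 gt_eqF. Qed.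

Lemma evol_weighted A g k l : 0 < g -> (forall k, A k \in unitmx) ->
  evol (weighted g A) k l = g ^ (l - k) *: evol A k l.
Proof.
move=> g0 hA; have gu : g \is a GRing.unit by rewrite unitfE gt_eqF.
move: k; apply: (@int_shift_ind _ l).
  by rewrite !evol_id subrr scale1r.
move=> k; rewrite !evolS//; last by move=> ?; exact: weighted_unit.
have -> : g ^ (l - (k + 1)) = g ^ (l - k) * g^-1.
  by rewrite opprD addrA !exprzDr.
rewrite /weighted -scalemxAl div1r (mulrC _ g^-1) -scalerA; split=> [->|].
  by rewrite -scalemxAr.
have gu' : g^-1 != 0 by rewrite invr_eq0 gt_eqF.
move/(can_inj (scalerK gu')); rewrite scalemxAr.
by apply: (can_inj (mulKmx (hA k))).
Qed.

Lemma invariant_projector_evol A P k l : (forall k, A k \in unitmx) ->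
  invariant_projector A P -> P k *m evol A k l = evol A k l *m P l.
Proof.
move=> hA [_ hP]; move: k; apply: (@int_shift_ind _ l).
  by rewrite evol_id mulmx1 mul1mx.
move=> k; rewrite !evolS// mulmxA hP -!mulmxA; split=> [->//|].
by move/(congr1 (mulmx (invmx (A k)))); rewrite !mulKmx.
Qed.

Lemma invariant_projector_weighted A P g : 0 < g ->
  invariant_projector (weighted g A) P <-> invariant_projector A P.
Proof.
move=> g0; have gu : 1 / g != 0 by rewrite div1r invr_eq0 gt_eqF.
split=> -[h1 h2]; split=> // k; last by rewrite /weighted -scalemxAr -scalemxAl h2.
have := h2 k; rewrite /weighted -scalemxAr -scalemxAl.
by apply: (can_inj (scalerK gu)).
Qed.

End Evolution.

(** * Dichotomies with a weight and their bundles *)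

Section Powers.
Variable R : realType.
Implicit Types x y q C : R.

(** In this form decay along an iteration is used without limits. *)
Lemma le_geometric0 q y C : 0 <= q < 1 ->
  (forall n : nat, y <= C * q ^+ n) -> y <= 0.
Proof.
move=> /andP[q0 q1] h; rewrite leNgt; apply/negP => y0.
have C0 : 0 < C by have := h 0; rewrite expr0 mulr1; exact: lt_le_trans.
have q1' : `|q| < 1 by rewrite ger0_norm.
have [n _ /(_ n (leqnn n)) /=] := cvgr_lt 0 (cvg_expr q1') _ (divr_gt0 y0 C0).
by rewrite ltr_pdivlMr// mulrC ltNge h.
Qed.

Lemma exprz_le x y (n : int) : 0 <= x <= y -> 0 <= n -> x ^ n <= y ^ n.
Proof.
case: n => // n /andP[x0 xy] _; rewrite -!exprnP.
by apply: lerXn2r => //; rewrite nnegrE// (le_trans x0).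
Qed.

Lemma exprz_le_neg x y (n : int) : 0 < x <= y -> n <= 0 -> y ^ n <= x ^ n.
Proof.
move=> /andP[x0 xy] n0; rewrite -(opprK n) -!(exprz_inv _ (- n)).
apply: exprz_le; last by lia.
have y0 : 0 < y by apply: lt_le_trans xy.
by rewrite invr_ge0 (ltW y0) lef_pV2.
Qed.

Lemma ereal_sup_image_ltyP (T : Type) (D : set T) (f : T -> R) :
  (ereal_sup [set (f k)%:E | k in D] < +oo)%E <->
  exists C, forall k, D k -> f k <= C.
Proof.
split=> [h|[C hC]]; last first.
  apply: (@le_lt_trans _ _ C%:E); last exact: ltry.
  by apply: ge_ereal_sup => _ [k Dk <-]; rewrite lee_fin hC.
have ub k : D k -> ((f k)%:E <= ereal_sup [set (f k)%:E | k in D])%E.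
  by move=> Dk; apply: ereal_sup_ubound; exists k.
case: (ereal_sup _) h ub => [r _ ub|//|_ ub].
  by exists r => k /ub; rewrite lee_fin.
by exists 0 => k /ub.
Qed.

End Powers.

Section Dichotomy.
Variables (R : realType) (N : nat) (nrm : 'cV[R]_N -> R).
Hypothesis hnrm : is_norm nrm.
Variable A : int -> 'M[R]_N.
Hypothesis hA : forall k, A k \in unitmx.
Implicit Types (P Q : int -> 'M[R]_N) (g : R).

(** The weight is absorbed in the rate: the strict inequality between b and g is
    what a rate of decay smaller than 1 of the weighted system amounts to. *)
Definition stable_estimate g P := exists b K : R,
  [/\ 0 < b < g, 0 <= K & forall k l : int, l <= k -> forall x,
     nrm (evol A k l *m P l *m x) <= K * b ^ (k - l) * nrm x].

Definition unstable_estimate g Q := exists b K : R,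
  [/\ g < b, 0 <= K & forall k l : int, k <= l -> forall x,
     nrm (evol A k l *m Q l *m x) <= K * b ^ (k - l) * nrm x].

Definition dichotomy g P :=
  [/\ 0 < g, invariant_projector A P, stable_estimate g P &
      unstable_estimate g (fun l => 1%:M - P l)].

Lemma stable_estimate_le g g' P : g <= g' ->
  stable_estimate g P -> stable_estimate g' P.
Proof.
move=> gg' [b [K [/andP[b0 bg] K0 h]]]; exists b, K; split=> //.
by rewrite b0 (lt_le_trans bg).
Qed.

Lemma unstable_estimate_le g g' Q : g <= g' ->
  unstable_estimate g' Q -> unstable_estimate g Q.
Proof.
move=> gg' [b [K [gb K0 h]]]; exists b, K; split=> //.
exact: le_lt_trans gb.
Qed.

Lemma stable_estimate_open g P : stable_estimate g P ->
  exists2 g', 0 < g' < g & stable_estimate g' P.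
Proof.
move=> [b [K [/andP[b0 bg] K0 h]]]; exists ((b + g) / 2).
  by apply/andP; split; lra.
by exists b, K; split=> //; apply/andP; split; lra.
Qed.

Lemma unstable_estimate_open g Q : unstable_estimate g Q ->
  exists2 g', g < g' & unstable_estimate g' Q.
Proof.
move=> [b [K [bg K0 h]]]; exists ((b + g) / 2); first by lra.
by exists b, K; split=> //; lra.
Qed.

Lemma stable_estimate0 g : 0 < g -> stable_estimate g (fun=> 0).
Proof.
move=> g0; exists (g / 2), 0; split=> //; first by apply/andP; split; lra.
by move=> k l _ x; rewrite mulmx0 mul0mx (is_norm0 hnrm) !mul0r.
Qed.

Lemma unstable_estimate0 g : unstable_estimate g (fun=> 0).
Proof.
exists (g + 1), 0; split=> //; first by lra.
by move=> k l _ x; rewrite mulmx0 mul0mx (is_norm0 hnrm) !mul0r.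
Qed.

Lemma dichotomy_strong_NED g P :
  dichotomy g P -> strong_NED nrm (weighted g A) 1.
Proof.
move=> [g0 hP [b1 [K1 [/andP[b10 b1g] K10 h1]]] [b2 [K2 [b2g K20 h2]]]].
have b20 : 0 < b2 by apply: lt_trans b2g.
(* A common rate for the two estimates of the weighted system. *)
pose a := Num.max (b1 / g) (g / b2).
have a0 : 0 < a by rewrite lt_max divr_gt0.
have a1 : a < 1 by rewrite gt_max !ltr_pdivrMr// !mul1r b1g.
exists P, a, (1 + K1 + K2); split; last by rewrite expr1n mulr1.
split; [split=> //|split].
- exact/invariant_projector_weighted.
- by rewrite a0.
- by lra.
- move=> k l lk; rewrite exp1rz mulr1.
  have ak : 0 <= a ^ (k - l) by apply: exprz_ge0; exact: ltW.
  apply: op_norm_le => //; first by apply: mulr_ge0 => //; lra.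
  move=> x; rewrite evol_weighted// -!scalemxAl; case: (hnrm) => _ -> _.
  have gl : 0 < g ^ (l - k) by apply: exprz_gt0.
  rewrite ger0_norm ?(ltW gl)//; apply: le_trans (ler_wpM2l (ltW gl) (h1 _ _ lk x)) _.
  rewrite !mulrA; apply: ler_wpM2r; first exact: is_norm_ge0.
  apply: (@le_trans _ _ (K1 * (b1 / g) ^ (k - l))).
    by rewrite expfzMl exprz_inv opprB mulrA (mulrC _ K1) mulrAC.
  apply: (@le_trans _ _ (K1 * a ^ (k - l))).
    apply: ler_wpM2l => //; apply: exprz_le; last by lia.
    by rewrite (divr_ge0 (ltW b10) (ltW g0)) /a le_max lexx.
  by apply: ler_wpM2r => //; lra.
- move=> k l kl; rewrite exp1rz mulr1.
  have ak : 0 <= (1 / a) ^ (k - l).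
    by apply: exprz_ge0; apply: ltW; rewrite divr_gt0.
  apply: op_norm_le => //; first by apply: mulr_ge0 => //; lra.
  move=> x; rewrite evol_weighted// -!scalemxAl; case: (hnrm) => _ -> _.
  have gl : 0 < g ^ (l - k) by apply: exprz_gt0.
  rewrite ger0_norm ?(ltW gl)//; apply: le_trans (ler_wpM2l (ltW gl) (h2 _ _ kl x)) _.
  rewrite !mulrA; apply: ler_wpM2r; first exact: is_norm_ge0.
  apply: (@le_trans _ _ (K2 * (b2 / g) ^ (k - l))).
    by rewrite expfzMl exprz_inv opprB mulrA (mulrC _ K2) mulrAC.
  apply: (@le_trans _ _ (K2 * (1 / a) ^ (k - l))).
    apply: ler_wpM2l => //; apply: exprz_le_neg; last by lia.
    rewrite divr_gt0//= ler_pdivrMr// mulrAC ler_pdivlMr// mul1r mulrC.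
    by rewrite -ler_pdivrMr// le_max lexx orbT.
  by apply: ler_wpM2r => //; lra.
Qed.

(** If the constant of nonuniformity exceeded 1, letting the initial time tend
    to minus infinity would make the norms of both complementary projections
    smaller than 1; both would vanish, although their sum is the identity. *)
Lemma strong_NED_eps1 (B : int -> 'M[R]_N) eps :
  (0 < N)%N -> strong_NED nrm B eps -> eps = 1.
Proof.
move=> N0 [P [a [K [[[hP a01 K1 e1] [hs hu]] _]]]].
apply/eqP; rewrite eq_le e1 andbT leNgt; apply/negP => e2.
have e0 : 0 < eps by lra.
(* The time l = - n at which both projections are shown to vanish. *)
have small : exists n : nat, K * eps^-1 ^+ n < 1.
  apply: contrapT => hn; have : (1 : R) <= 0.
    apply: (@le_geometric0 _ eps^-1 1 K).
      by rewrite invr_ge0 ltW//= invf_lt1.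
    by move=> n; rewrite leNgt; apply/negP => h; apply: hn; exists n.
  by rewrite ler10.
have [n hn] := small.
have Ke : K * eps ^ (- n%:Z) < 1 by rewrite -exprz_inv -exprnP.
have zero (M : 'M[R]_N) : M *m M = M ->
    op_norm nrm M <= K * eps ^ (- n%:Z) -> M = 0.
  move=> MM hM; apply: mulmx_cV_inj => x; rewrite mul0mx.
  case: (hnrm) => _ _; apply; apply/eqP; rewrite eq_le is_norm_ge0// andbT.
  have := op_norm_bound hnrm M (M *m x); rewrite mulmxA MM.
  set y := nrm _; have y0 : 0 <= y by exact: is_norm_ge0.
  by move: hM; nra.
have P0 : P (- n%:Z) = 0.
  apply: zero; first by case: hP.
  by have := hs (- n%:Z) _ (lexx _); rewrite evol_id mul1mx subrr expr0z mulr1.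
have Q0 : 1%:M - P (- n%:Z) = 0.
  apply: zero; first by rewrite P0 subr0 mul1mx.
  by have := hu (- n%:Z) _ (lexx _); rewrite evol_id mul1mx subrr expr0z mulr1.
by move: Q0; rewrite P0 subr0; exact: idmx_neq0.
Qed.

Lemma strong_NED_dichotomy g eps : (0 < N)%N -> 0 < g ->
  strong_NED nrm (weighted g A) eps -> exists P, dichotomy g P.
Proof.
move=> N0 g0 hs; have e1 := strong_NED_eps1 N0 hs; move: hs; rewrite {}e1.
move=> [P [a [K [[[hP /andP[a0 a1] K1 _] [hs hu]] _]]]]; exists P.
have gk (k l : int) : 0 < g ^ (l - k) by apply: exprz_gt0.
have Eg (k l : int) c : K * c ^ (k - l) = g ^ (l - k) * (K * (c * g) ^ (k - l)).
  have gg : g ^ (l - k) * g ^ (k - l) = 1.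
    by rewrite -exprzDr ?unitfE ?gt_eqF// -opprB addNr expr0z.
  by rewrite expfzMl !mulrA (mulrC _ K) -!mulrA (mulrCA _ (c ^ _)) gg mulr1.
split=> //; first exact/(invariant_projector_weighted _ _ g0).
- exists (a * g), K; split; [|by lra|].
    by rewrite mulr_gt0//= -ltr_pdivlMr// divff ?gt_eqF.
  move=> k l lk x; have := op_norm_bound hnrm (evol (weighted g A) k l *m P l) x.
  have := hs _ _ lk; rewrite exp1rz mulr1 => le1 le2.
  have := le_trans le2 (ler_wpM2r (is_norm_ge0 hnrm x) le1).
  rewrite evol_weighted// -!scalemxAl; case: (hnrm) => _ -> _.
  by rewrite ger0_norm ?(ltW (gk _ _))// Eg -!mulrA ler_pM2l// !mulrA.
- exists (1 / a * g), K; split; [|by lra|].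
    by rewrite mulrAC mul1r ltr_pdivlMr// gtr_pMr.
  move=> k l kl x.
  have := op_norm_bound hnrm (evol (weighted g A) k l *m (1%:M - P l)) x.
  have := hu _ _ kl; rewrite exp1rz mulr1 => le1 le2.
  have := le_trans le2 (ler_wpM2r (is_norm_ge0 hnrm x) le1).
  rewrite evol_weighted// -!scalemxAl; case: (hnrm) => _ -> _.
  by rewrite ger0_norm ?(ltW (gk _ _))// Eg -!mulrA ler_pM2l// !mulrA.
Qed.

Lemma stable_bundleP g l x :
  stable_bundle nrm A g 1 (l, x) <->
  exists C, forall k, l <= k -> nrm (evol A k l *m x) * g ^ (- k) <= C.
Proof.
rewrite /stable_bundle /= ereal_sup_image_ltyP.
by split=> -[C hC]; exists C => k lk; have := hC k lk; rewrite exp1rz mulr1.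
Qed.

Lemma unstable_bundleP g l x :
  unstable_bundle nrm A g 1 (l, x) <->
  exists C, forall k, k <= l -> nrm (evol A k l *m x) * g ^ (- k) <= C.
Proof.
rewrite /unstable_bundle /= ereal_sup_image_ltyP.
by split=> -[C hC]; exists C => k lk; have := hC k lk; rewrite exp1rz mulr1.
Qed.

Lemma stable_estimate_bundle g P l x : 0 < g -> stable_estimate g P ->
  P l *m x = x -> stable_bundle nrm A g 1 (l, x).
Proof.
move=> g0 [b [K [/andP[b0 bg] K0 h]]] hx; apply/stable_bundleP.
exists (K * g ^ (- l) * nrm x) => k lk.
have gk : 0 < g ^ (- k) by exact: exprz_gt0.
rewrite -{1}hx mulmxA.
apply: le_trans (ler_wpM2r (ltW gk) (h _ _ lk x)) _.
rewrite mulrAC; apply: ler_wpM2r; first exact: is_norm_ge0.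
rewrite -mulrA; apply: ler_wpM2l => //.
have -> : g ^ (- l) = g ^ (k - l) * g ^ (- k).
  by rewrite -exprzDr ?unitfE ?gt_eqF//; congr (_ ^ _); lia.
apply: ler_wpM2r; first exact: ltW.
by apply: exprz_le; [rewrite !ltW|lia].
Qed.

Lemma unstable_estimate_bundle g Q l x : 0 < g -> unstable_estimate g Q ->
  Q l *m x = x -> unstable_bundle nrm A g 1 (l, x).
Proof.
move=> g0 [b [K [bg K0 h]]] hx; apply/unstable_bundleP.
exists (K * g ^ (- l) * nrm x) => k kl.
have gk : 0 < g ^ (- k) by exact: exprz_gt0.
rewrite -{1}hx mulmxA.
apply: le_trans (ler_wpM2r (ltW gk) (h _ _ kl x)) _.
rewrite mulrAC; apply: ler_wpM2r; first exact: is_norm_ge0.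
rewrite -mulrA; apply: ler_wpM2l => //.
have -> : g ^ (- l) = g ^ (k - l) * g ^ (- k).
  by rewrite -exprzDr ?unitfE ?gt_eqF//; congr (_ ^ _); lia.
apply: ler_wpM2r; first exact: ltW.
by apply: exprz_le_neg; [rewrite g0 ltW|lia].
Qed.

(** Transport the component of x in the kernel of P forward to time l + n, where
    it is at most of size g ^ (l + n), and back to time l, which contracts by
    b ^ (- n) with g < b; letting n grow shows that the component is zero. *)
Lemma stable_bundle_fixed g P l x : 0 < g -> invariant_projector A P ->
  unstable_estimate g (fun l => 1%:M - P l) ->
  stable_bundle nrm A g 1 (l, x) -> P l *m x = x.
Proof.
move=> g0 hP [b [K [bg K0 h]]] /stable_bundleP[C hC].
have b0 : 0 < b by apply: lt_trans bg.
suff : nrm ((1%:M - P l) *m x) <= 0.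
  move=> y0; have /eqP : (1%:M - P l) *m x = 0.
    case: hnrm => _ _; apply; apply/eqP.
    by rewrite eq_le y0 is_norm_ge0.
  by rewrite mulmxBl mul1mx subr_eq0 eq_sym => /eqP.
apply: (@le_geometric0 _ (g / b) _ (K * (C * g ^ l))).
  by rewrite divr_ge0 ?ltW//= ltr_pdivrMr// mul1r.
move=> n; have lk : l <= l + n%:Z by lia.
have := h _ _ lk (evol A (l + n%:Z) l *m x).
rewrite -mulmxA (mulmxA (_ - _)) mulmxBl mul1mx.
rewrite (invariant_projector_evol _ _ hA hP).
rewrite -[X in X - _]mulmx1 -mulmxBr mulmxA mulmxA (evolK _ _ hA) mul1mx.
move/le_trans; apply.
have := hC _ lk; set y := nrm _ => hy.
have gn : 0 < g ^ (l + n%:Z) by exact: exprz_gt0.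
have hy' : y <= C * g ^ (l + n%:Z).
  by rewrite -ler_pdivrMr// invr_expz.
have -> : l - (l + n%:Z) = - n%:Z by lia.
apply: le_trans (ler_wpM2l _ hy') _.
  by rewrite mulr_ge0// exprz_ge0// ltW.
rewrite exprzDr ?unitfE ?gt_eqF// -exprz_inv -!exprnP expr_div_n exprVn.
by rewrite le_eqVlt; apply/orP; left; apply/eqP; ring.
Qed.

(** The time-reversed argument: the component of x in the range of P is
    transported backward to time l - n and forward again. *)
Lemma unstable_bundle_killed g P l x : 0 < g -> invariant_projector A P ->
  stable_estimate g P -> unstable_bundle nrm A g 1 (l, x) -> P l *m x = 0.
Proof.
move=> g0 hP [b [K [/andP[b0 bg] K0 h]]] /unstable_bundleP[C hC].
suff : nrm (P l *m x) <= 0.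
  move=> y0; case: hnrm => _ _; apply; apply/eqP.
  by rewrite eq_le y0 is_norm_ge0.
apply: (@le_geometric0 _ (b / g) _ (K * (C * g ^ l))).
  by rewrite divr_ge0 ?ltW//= ltr_pdivrMr// mul1r.
move=> n; have lk : l - n%:Z <= l by lia.
have := h _ _ lk (evol A (l - n%:Z) l *m x).
rewrite -mulmxA (mulmxA (P _)).
rewrite (invariant_projector_evol _ _ hA hP).
rewrite mulmxA mulmxA (evolK _ _ hA) mul1mx.
move/le_trans; apply.
have := hC _ lk; set y := nrm _ => hy.
have gn : 0 < g ^ (l - n%:Z) by exact: exprz_gt0.
have hy' : y <= C * g ^ (l - n%:Z).
  by rewrite -ler_pdivrMr// invr_expz.
have -> : l - (l - n%:Z) = n%:Z by lia.
apply: le_trans (ler_wpM2l _ hy') _.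
  by rewrite mulr_ge0// exprz_ge0// ltW.
rewrite exprzDr ?unitfE ?gt_eqF// -exprz_inv -!exprnP expr_div_n exprVn.
by rewrite le_eqVlt; apply/orP; left; apply/eqP; ring.
Qed.

Lemma stable_bundleE g P : dichotomy g P ->
  stable_bundle nrm A g 1 = [set p | P p.1 *m p.2 = p.2].
Proof.
move=> [g0 hP hs hu]; apply/seteqP; split=> -[l x] /=.
  exact: stable_bundle_fixed.
exact: stable_estimate_bundle.
Qed.

Lemma unstable_bundleE g P : dichotomy g P ->
  unstable_bundle nrm A g 1 = [set p | P p.1 *m p.2 = 0].
Proof.
move=> [g0 hP hs hu]; apply/seteqP; split=> -[l x] /=.
  exact: unstable_bundle_killed.
move=> Px; apply: unstable_estimate_bundle hu _ => //.
by rewrite mulmxBl mul1mx Px subr0.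
Qed.

End Dichotomy.

(** * Gap points and their projectors *)

Section Projectors.
Variables (R : realType) (N : nat).
Implicit Types (p q : 'M[R]_N) (P Q : int -> 'M[R]_N).

(** The order of commuting projectors: smaller range and larger kernel. *)
Definition proj_le p q := p *m q = p /\ q *m p = p.

Lemma proj_le_rank p q : proj_le p q -> (\rank p <= \rank q)%N.
Proof. by move=> [<- _]; exact: mxrankM_maxr. Qed.

(** p factors through q, so its row space lies in that of q; equal ranks make the
    row spaces equal, so that q = d p and q = q p = p. *)
Lemma proj_le_rank_eq p q : p *m p = p ->
  proj_le p q -> \rank p = \rank q -> p = q.
Proof.
move=> pp [pq qp] r.
have /submxP[d qd] : (q <= p)%MS.
  have pleq : (p <= q)%MS by rewrite -pq submxMl.
  by have [_ <-] := mxrank_leqif_sup pleq; rewrite r.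
by rewrite -qp {1}qd -mulmxA pp -qd.
Qed.

Lemma proj_le_anti p q : proj_le p q -> proj_le q p -> p = q.
Proof. by move=> [pq _] [_ pq']; rewrite -pq. Qed.

Lemma invariant_projector_conj A P l : (forall k, A k \in unitmx) ->
  invariant_projector A P -> P l = evol A l 0 *m P 0 *m evol A 0 l.
Proof.
move=> hA hP; rewrite -(invariant_projector_evol _ _ hA hP) -mulmxA.
by rewrite evolK// mulmx1.
Qed.

Lemma invariant_projector_inj A P Q : (forall k, A k \in unitmx) ->
  invariant_projector A P -> invariant_projector A Q -> P 0 = Q 0 -> P = Q.
Proof.
move=> hA hP hQ e; apply/funext => l.
by rewrite (invariant_projector_conj _ hA hP) e -invariant_projector_conj.
Qed.

End Projectors.

Section Gaps.
Variables (R : realType) (N : nat) (nrm : 'cV[R]_N -> R).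
Hypothesis N0 : (0 < N)%N.
Hypothesis hnrm : is_norm nrm.
Variable A : int -> 'M[R]_N.
Hypothesis hA : forall k, A k \in unitmx.
Implicit Types (P Q : int -> 'M[R]_N) (g x : R) (c : \bar R).

Local Notation res := (ned_resolvent nrm A).
Local Notation dichotomy := (dichotomy nrm A).

Lemma ned_resolventP g : res g <-> exists P, dichotomy g P.
Proof.
rewrite /ned_resolvent /ned_spectrum /=; split=> [[g0 h]|[P hP]].
  have [eps he] : exists eps, strong_NED nrm (weighted g A) eps.
    by apply: contrapT => he; apply: h.
  exact: (strong_NED_dichotomy hnrm hA N0 g0 he).
have [g0 _ _ _] := hP; split=> // -[_]; apply.
by exists 1; exact: (dichotomy_strong_NED hnrm hA hP).
Qed.

(** Orbits in the range of P are bounded for the weight g, hence for the larger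
    weight g', hence lie in the range of P'; dually for the kernels. *)
Lemma dichotomy_le g g' P P' : g <= g' -> dichotomy g P -> dichotomy g' P' ->
  forall l, proj_le (P l) (P' l).
Proof.
move=> gg' [g0 hP hs _] [g0' hP' _ hu] l.
have [[PP _] [PP' _]] := (hP, hP').
split; apply: mulmx_cV_inj => x; last first.
  rewrite -mulmxA; apply: (stable_bundle_fixed hnrm hA g0' hP' hu).
  apply: (stable_estimate_bundle hnrm g0' (stable_estimate_le gg' hs)).
  by rewrite mulmxA PP.
apply/eqP; rewrite eq_sym -subr_eq0 -mulmxA -mulmxBr; apply/eqP.
apply: (unstable_bundle_killed hnrm hA g0 hP hs).
apply: (unstable_estimate_bundle hnrm g0 (unstable_estimate_le gg' hu)).
by rewrite mulmxBr mulmxBl mul1mx mulmxBl mul1mx mulmxA PP' subrr subr0.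
Qed.

Lemma dichotomy_uniq g P P' : dichotomy g P -> dichotomy g P' -> P = P'.
Proof.
move=> h h'; apply/funext => l.
by apply: proj_le_anti; apply: dichotomy_le (lexx g) _ _ _.
Qed.

Lemma dichotomy_between g g' x P : g <= x <= g' ->
  dichotomy g P -> dichotomy g' P -> dichotomy x P.
Proof.
move=> /andP[gx xg'] [g0 hP hs _] [_ _ _ hu]; split=> //.
- exact: lt_le_trans gx.
- exact: stable_estimate_le hs.
- exact: unstable_estimate_le hu.
Qed.

Lemma dichotomy_open g P : dichotomy g P ->
  exists g1 g2, [/\ g1 < g < g2, dichotomy g1 P & dichotomy g2 P].
Proof.
move=> [g0 hP hs hu].
have [g1 /andP[g10 g1g] hs1] := stable_estimate_open hs.
have [g2 gg2 hu2] := unstable_estimate_open hu.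
exists g1, g2; split; [by rewrite g1g| |]; split=> //.
- exact: unstable_estimate_le (ltW g1g) hu.
- exact: lt_trans gg2.
- exact: stable_estimate_le (ltW gg2) hs.
Qed.

(** The projector of a dichotomy is locally constant in the weight, hence
    constant on a segment of the resolvent set. *)
Lemma dichotomy_segment g g' P P' : g <= g' ->
  (forall x, g <= x <= g' -> res x) ->
  dichotomy g P -> dichotomy g' P' -> P = P'.
Proof.
move=> gg' hres hP hP'.
pose S := [set x | g <= x <= g' /\ dichotomy x P].
have Sg : S g by split=> //; rewrite lexx.
have hS : has_sup S.
  by split; [exists g|exists g' => x [/andP[_]]].
set s := sup S.
have gs : g <= s by exact: sup_upper_bound.
have sg' : s <= g' by apply: ge_sup; [exists g|move=> x [/andP[_]]].
have /ned_resolventP[Q hQ] : res s by apply: hres; rewrite gs.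
have [g1 [g2 [/andP[g1s sg2] h1 h2]]] := dichotomy_open hQ.
have eQ y : g1 <= y <= g2 -> dichotomy y Q.
  by move=> hy; exact: dichotomy_between hy h1 h2.
have sg1 : 0 < s - g1 by rewrite subr_gt0.
have [y Sy] := sup_adherent sg1 hS; rewrite -/s subKr => g1y.
have ys : y <= g2 by apply: le_trans (ltW sg2); exact: sup_upper_bound.
have [_ yP] := Sy.
(* P and the projector Q at the supremum s are both projectors at y, just below s. *)
have PQ : P = Q by apply: dichotomy_uniq yP (eQ _ _); rewrite (ltW g1y).
rewrite -{}PQ in eQ.
have [sg|g's] := ltP s g'.
  have : Num.min g2 g' <= s.
    apply: sup_upper_bound => //; split.
      by rewrite ge_min le_min lexx orbT (le_trans gs (ltW sg2)) gg'.
    apply: eQ; rewrite ge_min lexx le_min /= (ltW (lt_trans g1s sg2)).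
    by rewrite (ltW (lt_trans g1s sg)).
  by rewrite leNgt lt_min sg2 sg.
have es : s = g' by apply/eqP; rewrite eq_le sg'.
apply: dichotomy_uniq hP'; rewrite -es.
by apply: eQ; rewrite (ltW g1s) (ltW sg2).
Qed.

(** The resolvent set completed by a point 0 with projector 0, resp. a point
    +oo with projector Id, when it has no low, resp. no high gap.  These are the
    projectors that the statement attaches to a missing end gap, and with them
    every point of the spectrum has a gap on both sides. *)
Definition gap c P :=
  [\/ exists2 g, c = g%:E & dichotomy g P,
      [/\ c = 0%E, ~ (exists x, low_gap nrm A x) & P = fun=> 0] |
      [/\ c = +oo%E, ~ (exists x, high_gap nrm A x) & P = fun=> 1%:M]].

Lemma gap_proj c P : gap c P -> invariant_projector A P.
Proof.
case=> [[g _ [_]]//|[_ _ ->]|[_ _ ->]]; split=> k.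
- by rewrite mul0mx.
- by rewrite mul0mx mulmx0.
- by rewrite mulmx1.
- by rewrite mulmx1 mul1mx.
Qed.

Lemma gap_ge0 c P : gap c P -> (0 <= c)%E.
Proof.
case=> [[g -> [g0 _ _ _]]|[-> _ _]|[-> _ _]] //.
by rewrite lee_fin ltW.
Qed.

Lemma gap_le c c' P P' : (c <= c')%E -> gap c P -> gap c' P' ->
  forall l, proj_le (P l) (P' l).
Proof.
move=> cc' h [[g' e' h']|[e' _ ->]|[_ _ ->]] l; last first.
- by split; rewrite ?mulmx1 ?mul1mx.
- move: h cc'; rewrite {}e' => -[[g -> [g0 _ _ _]]|[_ _ ->] _|[-> _ _]] //.
    by rewrite lee_fin leNgt g0.
  by split; rewrite mulmx0.
- move: h cc'; rewrite {}e' => -[[g -> h]|[_ _ ->] _|[-> _ _]] //.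
    by rewrite lee_fin => gg'; exact: dichotomy_le gg' h h' l.
  by split; rewrite ?mulmx0 ?mul0mx.
Qed.

Lemma gap_rank_le c c' P P' : (c <= c')%E -> gap c P -> gap c' P' ->
  (\rank (P 0%Z) <= \rank (P' 0%Z))%N.
Proof. by move=> cc' h h'; apply: proj_le_rank; exact: gap_le cc' h h' _. Qed.

Lemma gap_rank_inj c c' P P' : gap c P -> gap c' P' ->
  \rank (P 0%Z) = \rank (P' 0%Z) -> P = P'.
Proof.
wlog cc' : c c' P P' / (c <= c')%E.
  move=> H h h' r; have [cc'|/ltW cc'] := leP c c'; first exact: (H c c').
  by apply/esym; apply: (H c' c).
move=> h h' r; apply: invariant_projector_inj (gap_proj h) (gap_proj h') _ => //.
apply: proj_le_rank_eq => //; first by case: (gap_proj h).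
exact: gap_le cc' h h' _.
Qed.

(** The stable estimate comes from the left end, the unstable one from the right
    end; at a virtual end the corresponding projector is 0. *)
Lemma gap_between c c' P x : (c < x%:E < c')%E -> gap c P -> gap c' P -> res x.
Proof.
move=> /andP[cx xc'] h h'; apply/ned_resolventP; exists P.
have hP := gap_proj h.
have hs : stable_estimate nrm A x P.
  case: h cx => [[g -> [_ _ hs _]]|[-> _ ->]|[-> _ _]] //; rewrite lte_fin.
    by move/ltW/stable_estimate_le; exact.
  exact: stable_estimate0.
have hu : unstable_estimate nrm A x (fun l => 1%:M - P l).
  case: h' xc' => [[g -> [_ _ _ hu]]|[-> _ _]|[-> _ ->]] //; last 1 first.
  - by rewrite subrr => _; exact: unstable_estimate0.
  - by rewrite lte_fin; move/ltW/unstable_estimate_le; exact.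
  - by move/(lt_trans cx); rewrite ltNge (gap_ge0 h).
split=> //; rewrite -lte_fin; exact: le_lt_trans (gap_ge0 h) cx.
Qed.

(** Otherwise the points in between would form a segment of the resolvent set,
    or, at a virtual end, make up an end gap whose absence is assumed. *)
Lemma gap_separated c c' P P' : gap c P -> gap c' P' ->
  (\rank (P 0%Z) < \rank (P' 0%Z))%N ->
  exists x, [/\ 0 < x, ~ res x & (c < x%:E < c')%E].
Proof.
move=> h h' r; have cc' : (c < c')%E.
  by rewrite ltNge; apply/negP => c'c; move: r; rewrite ltnNge (gap_rank_le c'c h' h).
apply: contrapT => hx.
have {}hx x : 0 < x -> (c < x%:E < c')%E -> res x.
  by move=> x0 cx; apply: contrapT => hr; apply: hx; exists x.
case: h h' cc' hx r => [[g -> h]|[-> hl ->]|[-> _ _]].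
- have [g0 _ _ _] := h.
  case=> [[g' -> h']|[-> _ _]|[-> hh' _]] cc' hx r.
  + rewrite lte_fin in cc'.
    suff PP' : P = P' by move: r; rewrite PP' ltnn.
    apply: (dichotomy_segment (ltW cc') _ h h') => x /andP[gx xg'].
    move: gx; rewrite le_eqVlt => /predU1P[<-|gx].
      by apply/ned_resolventP; exists P.
    move: xg'; rewrite le_eqVlt => /predU1P[->|xg'].
      by apply/ned_resolventP; exists P'.
    by apply: hx; [exact: lt_trans gx|rewrite !lte_fin gx].
  + by move: cc'; rewrite lte_fin ltNge ltW.
  + apply: hh'; exists g; split; first by apply/ned_resolventP; exists P.
    move=> x gx; apply: hx; first exact: lt_trans gx.
    by rewrite lte_fin gx ltry.
- case=> [[g' -> h']|[-> _ ->]|[-> hh' _]] cc' hx r.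
  + apply: hl; exists g'; split; first by apply/ned_resolventP; exists P'.
    by move=> x /andP[x0 xg']; apply: hx => //; rewrite !lte_fin x0.
  + by move: cc'; rewrite ltxx.
  + apply: hl; exists 1; split; first by apply: hx => //; rewrite lte01 ltry.
    by move=> x /andP[x0 _]; apply: hx => //; rewrite lte_fin x0 ltry.
- by move=> _ /lt_le_trans/(_ (leey _)); rewrite ltxx.
Qed.

Lemma gap_below x : 0 < x -> ~ res x -> exists c P, gap c P /\ (c < x%:E)%E.
Proof.
move=> x0 hx; have [[g [hg hl]]|hl] := pselect (exists x, low_gap nrm A x).
  have /ned_resolventP[P hP] := hg.
  exists g%:E, P; split; first by constructor 1; exists g.
  rewrite lte_fin ltNge le_eqVlt; apply/negP => /predU1P[e|xg].
    by apply: hx; rewrite e.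
  by apply: hx; apply: hl; rewrite x0.
by exists 0%E, (fun=> 0); split; [constructor 2|rewrite lte_fin].
Qed.

Lemma gap_above x : 0 < x -> ~ res x -> exists c P, gap c P /\ (x%:E < c)%E.
Proof.
move=> x0 hx; have [[g [hg hl]]|hl] := pselect (exists x, high_gap nrm A x).
  have /ned_resolventP[P hP] := hg.
  exists g%:E, P; split; first by constructor 1; exists g.
  rewrite lte_fin ltNge le_eqVlt; apply/negP => /predU1P[e|xg].
    by apply: hx; rewrite -e.
  by apply: hx; apply: hl.
by exists +oo%E, (fun=> 1%:M); split; [constructor 3|rewrite ltry].
Qed.

Lemma gap_exists : exists c P, gap c P.
Proof.
have [[g [/ned_resolventP[P hP] _]]|hl] := pselect (exists x, low_gap nrm A x).
  by exists g%:E, P; constructor 1; exists g.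
by exists 0%E, (fun=> 0); constructor 2.
Qed.

Lemma gap_real g P : 0 < g -> gap g%:E P -> dichotomy g P.
Proof. by move=> g0; case=> [[_ [<-]//]|[[g00]]|[]//]; rewrite g00 ltxx in g0. Qed.

Lemma gap0P P : gap 0%E P -> ~ (exists x, low_gap nrm A x) /\ P = fun=> 0.
Proof.
by case=> [[g [<-] [/=]]|[_ hl ->]|[]//]; rewrite ?ltxx.
Qed.

Lemma gapyP P :
  gap +oo%E P -> ~ (exists x, high_gap nrm A x) /\ P = fun=> 1%:M.
Proof. by case=> [[]//|[]//|[_ hl ->]]. Qed.

(** A genuine gap point with projector 0 would extend to a low gap. *)
Lemma gap0_isolated c P P' : gap 0%E P -> gap c P' ->
  \rank (P 0%Z) = \rank (P' 0%Z) -> c = 0%E.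
Proof.
move=> h h' /(gap_rank_inj h h') PP'; rewrite -{}PP' in h'.
have [hl P0] := gap0P h; case: (h') => [[g e hP]|[]//|[_ _ P1]].
  have [g0 _ _ _] := hP; case: hl; exists g; split.
    by apply/ned_resolventP; exists P.
  by move=> x gx; apply: (gap_between _ h h'); rewrite e !lte_fin.
by case: (idmx_neq0 (R := R) N0); rewrite -(congr1 (fun f => f 0%Z) P1) P0.
Qed.

(** A genuine gap point with projector Id would extend to a high gap. *)
Lemma gapy_isolated c P P' : gap +oo%E P -> gap c P' ->
  \rank (P 0%Z) = \rank (P' 0%Z) -> c = +oo%E.
Proof.
move=> h h' /(gap_rank_inj h h') PP'; rewrite -{}PP' in h'.
have [hl P1] := gapyP h; case: (h') => [[g e hP]|[_ _ P0]|[]//].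
  have [g0 _ _ _] := hP; case: hl; exists g; split.
    by apply/ned_resolventP; exists P.
  by move=> x gx; apply: (gap_between _ h' h); rewrite e lte_fin gx ltry.
by case: (idmx_neq0 (R := R) N0); rewrite -(congr1 (fun f => f 0%Z) P0) P1.
Qed.

End Gaps.

(** * Decomposition of the half-line by an increasing rank *)

(** The order-theoretic content of the spectral theorem: [lev c d] stands for a
    gap point c of rank d, and [rho] for the resolvent set.  The hypotheses are
    the properties of gap points proved above. *)
Section Levels.
Variables (R : realType) (N : nat) (rho : set R) (lev : \bar R -> nat -> Prop).
Hypothesis lev_leN : forall c d, lev c d -> (d <= N)%N.
Hypothesis lev_ex : exists c d, lev c d.
Hypothesis lev_ge0 : forall c d, lev c d -> (0 <= c)%E.
Hypothesis lev_mono : forall c d c' d',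
  lev c d -> lev c' d' -> (c <= c')%E -> (d <= d')%N.
Hypothesis lev_between : forall c c' d x,
  lev c d -> lev c' d -> (c < x%:E < c')%E -> rho x.
Hypothesis lev_sep : forall c d c' d', lev c d -> lev c' d' -> (d < d')%N ->
  exists x, [/\ 0 < x, ~ rho x & (c < x%:E < c')%E].
Hypothesis lev_below : forall x, 0 < x -> ~ rho x ->
  exists c d, lev c d /\ (c < x%:E)%E.
Hypothesis lev_above : forall x, 0 < x -> ~ rho x ->
  exists c d, lev c d /\ (x%:E < c)%E.
Hypothesis lev_rho : forall x, rho x -> exists d, lev x%:E d.
Hypothesis lev_real : forall x d, 0 < x -> lev x%:E d -> rho x.
Hypothesis lev_open : forall x d, 0 < x -> lev x%:E d ->
  exists x1 x2, [/\ x1 < x < x2, lev x1%:E d & lev x2%:E d].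
Hypothesis lev0 : forall c d, lev 0%E d -> lev c d -> c = 0%E.
Hypothesis levy : forall c d, lev +oo%E d -> lev c d -> c = +oo%E.

Lemma lev_lt_all x c d : 0 < x -> ~ rho x -> lev c d -> (c < x%:E)%E ->
  forall c', lev c' d -> (c' < x%:E)%E.
Proof.
move=> x0 hx h cx c' h'; rewrite ltNge le_eqVlt; apply/negP => /predU1P[e|xc'].
  by apply: hx; apply: (@lev_real _ d) => //; rewrite e.
by apply: hx; apply: lev_between h h' _; rewrite cx.
Qed.

Lemma lev_gt_all x c d : 0 < x -> ~ rho x -> lev c d -> (x%:E < c)%E ->
  forall c', lev c' d -> (x%:E < c')%E.
Proof.
move=> x0 hx h cx c' h'; rewrite ltNge le_eqVlt; apply/negP => /predU1P[e|xc'].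
  by apply: hx; apply: (@lev_real _ d) => //; rewrite -e.
by apply: hx; apply: lev_between h' h _; rewrite cx andbT.
Qed.

(* The ranks that occur, in increasing order. *)
Let s := [seq d <- iota 0 N.+1 | `[< exists c, lev c d >]].
Let n := (size s).-1.
Let S i := nth 0%N s i.

Local Lemma mem_levels d : (d \in s) = `[< exists c, lev c d >].
Proof.
rewrite mem_filter mem_iota /=; apply/andP/idP => [[]//|h]; split=> //.
by have /asboolP[c /lev_leN] := h.
Qed.

Local Lemma size_levels : size s = n.+1.
Proof.
rewrite /n prednK//; have [c [d h]] := lev_ex.
have : d \in s by rewrite mem_levels; apply/asboolP; exists c.
by case: s.
Qed.

Local Lemma level_count : (n <= N)%N.
Proof.
have : (size s <= N.+1)%N by rewrite size_filter -{2}(size_iota 0 N.+1) count_size.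
by rewrite size_levels.
Qed.

Local Lemma levels_lev i : (i <= n)%N -> exists c, lev c (S i).
Proof.
move=> iN; have : S i \in s by rewrite mem_nth// size_levels.
by rewrite mem_levels => /asboolP.
Qed.

Local Lemma levels_lt i j : (i < j)%N -> (j <= n)%N -> (S i < S j)%N.
Proof.
move=> ij jn; apply: (sorted_ltn_nth ltn_trans) => //.
- by apply: sorted_filter; [exact: ltn_trans|exact: iota_ltn_sorted].
- by rewrite inE size_levels ltnS ltnW// (leq_trans ij).
- by rewrite inE size_levels ltnS.
Qed.

Local Lemma levels_onto c d : lev c d -> exists2 i, (i <= n)%N & d = S i.
Proof.
move=> h; have ds : d \in s by rewrite mem_levels; apply/asboolP; exists c.
exists (index d s); last by rewrite /S nth_index.
by rewrite -ltnS -size_levels index_mem.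
Qed.

Local Lemma levels_sep i : (1 <= i <= n)%N -> exists x,
  [/\ 0 < x, ~ rho x, forall c, lev c (S i.-1) -> (c < x%:E)%E &
      forall c, lev c (S i) -> (x%:E < c)%E].
Proof.
move=> /andP[i1 iN].
have [c h] : exists c, lev c (S i.-1) by apply: levels_lev; lia.
have [c' h'] := levels_lev iN.
have lt : (S i.-1 < S i)%N by apply: levels_lt => //; lia.
have [x [x0 hx /andP[cx xc]]] := lev_sep h h' lt.
by exists x; split=> //; [exact: lev_lt_all h cx|exact: lev_gt_all h' xc].
Qed.

Let zl := `[< exists d, lev 0%E d >].
Let zr := `[< exists d, lev +oo%E d >].
Let C d : set R := [set x | lev x%:E d].

Local Lemma level_zero d : lev 0%E d -> d = S 0.
Proof.
move=> h; have [c h0] := levels_lev (leq0n n).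
have [[|i] iN e] := levels_onto h; first by [].
have : (d <= S 0)%N by apply: lev_mono h h0 (lev_ge0 h0).
by rewrite e leqNgt levels_lt.
Qed.

Local Lemma level_infty d : lev +oo%E d -> d = S n.
Proof.
move=> h; have [c h0] := levels_lev (leqnn n).
have [i iN e] := levels_onto h; move: iN; rewrite leq_eqVlt => /predU1P[<-//|iN].
have : (S n <= d)%N by apply: lev_mono h0 h (leey _).
by rewrite e leqNgt levels_lt.
Qed.

Local Lemma level_pos j x : (j <= n)%N -> ~~ ((j == 0)%N && zl) -> C (S j) x -> 0 < x.
Proof.
move=> jn hz h; rewrite lt0r; have := lev_ge0 h; rewrite lee_fin => ->.
rewrite andbT; apply/eqP => x0; rewrite /C /= x0 in h.
have e := level_zero h; move: hz; have -> /= : zl by apply/asboolP; exists (S j).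
by case: j e {h} jn => // j /esym e jn; move: (levels_lt (ltn0Sn j) jn); rewrite e ltnn.
Qed.

Local Lemma level_real j : (j <= n)%N -> ~~ ((j == 0)%N && zl) ->
  ~~ ((j == n)%N && zr) -> C (S j) !=set0.
Proof.
move=> jn hl hr; have [c h] := levels_lev jn; case: c h => [x|h|/lev_ge0//].
  by exists x.
have e := level_infty h; move: hr; have -> : zr by apply/asboolP; exists (S j).
rewrite andbT; move: jn; rewrite leq_eqVlt => /orP[->//|jn].
by move: (levels_lt jn (leqnn n)); rewrite e ltnn.
Qed.

(* The interval of index i reaches from the supremum of the gap of index i - 1 to
   the infimum of the gap of index i.  An end at a virtual gap point is not an
   end of the interval and only has to satisfy 0 < a i <= b i, for which it is
   set equal to the other end, or to 1 if both are virtual. *)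
Let a i := if (i == 1)%N && zl
  then (if (i == n)%N && zr then 1 else inf (C (S i))) else sup (C (S i.-1)).
Let b i := if (i == n)%N && zr then a i else inf (C (S i)).

Local Lemma level_sup_le i x : (1 <= i <= n)%N -> ~~ ((i == 1)%N && zl) ->
  (forall y, C (S i.-1) y -> y < x) -> a i <= x /\ has_sup (C (S i.-1)).
Proof.
move=> hi hz hx; rewrite /a (negbTE hz).
have C0 : C (S i.-1) !=set0.
  by apply: level_real; [lia|move: hz; case: (i) hi => [|[|i']]|apply/negP => /andP[/eqP]; lia].
split; first by apply: ge_sup => // y /hx /ltW.
by split=> //; exists x => y /hx /ltW.
Qed.

Local Lemma level_inf_ge i x : (1 <= i <= n)%N -> ~~ ((i == n)%N && zr) ->
  (forall y, C (S i) y -> x <= y) -> x <= inf (C (S i)) /\ has_inf (C (S i)).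
Proof.
move=> hi hz hx.
have C0 : C (S i) !=set0.
  by apply: level_real => //; [lia|apply/negP => /andP[/eqP]; lia].
split; first by apply: lb_le_inf.
by split=> //; exists x.
Qed.

Local Lemma level_ends i : (1 <= i <= n)%N -> 0 < a i <= b i.
Proof.
move=> hi; have [x [x0 _ h1 h2]] := levels_sep hi.
have {}h1 y : C (S i.-1) y -> y < x by move=> /h1; rewrite lte_fin.
have {}h2 y : C (S i) y -> x <= y by move=> /h2; rewrite lte_fin => /ltW.
have [/andP[/eqP i1 hz]|hz] := boolP ((i == 1)%N && zl).
  rewrite /b /a i1 hz /= -i1; case: ifP => [_|/negbT hr]; first by rewrite ltr01 lexx.
  have [xi _] := level_inf_ge hi hr h2.
  by rewrite (lt_le_trans x0 xi) lexx.
have [ax hs] := level_sup_le hi hz h1.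
have a0 : 0 < a i.
  have [y Cy] := hs.1; apply: (@lt_le_trans _ _ y).
    apply: level_pos Cy; first by lia.
    by move: hz; case: (i) hi => [|[|i']].
  by rewrite /a (negbTE hz); apply: sup_upper_bound.
rewrite a0 /b /=; case: ifPn => [//|hr].
by have [xi _] := level_inf_ge hi hr h2; exact: le_trans ax xi.
Qed.

Local Lemma level_interior i : (1 <= i < n)%N ->
  [/\ b i = inf (C (S i)), a i.+1 = sup (C (S i)), has_inf (C (S i)) &
      has_sup (C (S i))].
Proof.
move=> hi; have hr : ~~ ((i == n)%N && zr) by apply/negP => /andP[/eqP]; lia.
have hl : ~~ ((i.+1 == 1)%N && zl) by apply/negP => /andP[/eqP]; lia.
have hi1 : (1 <= i <= n)%N by lia.
have hi2 : (1 <= i.+1 <= n)%N by lia.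
have [x [_ _ _ h2]] := levels_sep hi1; have [y [_ _ h1 _]] := levels_sep hi2.
have [_ hinf] : x <= inf (C (S i)) /\ has_inf (C (S i)).
  by apply: level_inf_ge => // z /h2; rewrite lte_fin => /ltW.
have [_ hsup] : a i.+1 <= y /\ has_sup (C (S i.+1.-1)).
  by apply: level_sup_le => // z /h1; rewrite lte_fin.
by split=> //; rewrite /b ?(negbTE hr)// /a (negbTE hl).
Qed.

(** The gap between two intervals is open and nonempty, so its ends differ. *)
Local Lemma levels_order i : (1 <= i < n)%N -> b i < a i.+1.
Proof.
move=> hi; have [-> -> hinf hsup] := level_interior hi.
have [y Cy] := hsup.1.
have y0 : 0 < y by apply: level_pos Cy; [lia|apply/negP => /andP[/eqP]; lia].
have [x1 [x2 [/andP[h1 h2] C1 C2]]] := lev_open y0 Cy.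
apply: (@le_lt_trans _ _ x1); first exact: (ge_inf hinf.2 C1).
apply: (lt_trans h1); apply: (lt_le_trans h2).
exact: (sup_upper_bound hsup C2).
Qed.

Local Lemma level_of_interior i x : (1 <= i < n)%N -> rho x ->
  b i < x < a i.+1 -> lev x%:E (S i).
Proof.
move=> hi hx; have [-> -> hinf hsup] := level_interior hi => /andP[bx xa].
have [y Cy yx] := inf_lt hinf.1 bx.
have [z Cz xz] := sup_gt hsup.1 xa.
have [d h] := lev_rho hx.
suff -> : S i = d by [].
apply/eqP; rewrite eqn_leq; apply/andP; split.
  by apply: (lev_mono Cy h); rewrite lee_fin ltW.
by apply: (lev_mono h Cz); rewrite lee_fin ltW.
Qed.

(** A spectral point has every gap either below or above it; the first gap that
    is not below it closes the interval that contains it. *)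
Local Lemma spectrum_covered x : 0 < x -> ~ rho x ->
  exists2 i, (1 <= i <= n)%N & x \in spectral_interval n zl zr a b i.
Proof.
move=> x0 hx; (* The levels that are not below x. *)
pose up d := ~~ `[< exists2 c, lev c d & (c < x%:E)%E >].
have hup : has up s.
  have [c [d [h xc]]] := lev_above x0 hx.
  apply/hasP; exists d; first by rewrite mem_levels; apply/asboolP; exists c.
  apply/negP => /asboolP[c' h' c'x].
  by have := lev_gt_all x0 hx h xc h'; rewrite ltNge (ltW c'x).
pose i := find up s.
have iN : (i <= n)%N by rewrite -ltnS -size_levels -has_find.
have upi c : lev c (S i) -> (x%:E <= c)%E.
  move=> h; rewrite leNgt; apply/negP => cx.
  by have /negP := nth_find 0%N hup; apply; apply/asboolP; exists c.
have i1 : (1 <= i)%N.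
  rewrite lt0n; apply/eqP => i0; rewrite i0 in upi.
  have [c [d [h cx]]] := lev_below x0 hx.
  have [c0 h0] := levels_lev (leq0n n).
  have dS : (d <= S 0)%N.
    by apply: (lev_mono h h0); exact: le_trans (ltW cx) (upi _ h0).
  have [[|j] jn e] := levels_onto h.
    by have := upi _ (eq_ind d (lev c) h _ e); rewrite leNgt cx.
  by move: dS; rewrite e leqNgt levels_lt.
have hi : (1 <= i <= n)%N by rewrite i1.
have dn : forall y, C (S i.-1) y -> y < x.
  have : up (S i.-1) = false by apply: before_find; rewrite -/i; lia.
  move=> /negbFE/asboolP[c h cx] y /(lev_lt_all x0 hx h cx).
  by rewrite lte_fin.
exists i => //; rewrite /spectral_interval itv_boundlr; apply/andP; split.
  case: ifPn => hz; rewrite bnd_simp//.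
  by have [] := level_sup_le hi hz dn.
case: ifPn => hz; rewrite bnd_simp// /b (negbTE hz).
by have [] := level_inf_ge (x := x) hi hz (fun y => upi y%:E).
Qed.

(** A gap point in the interval of index i would have a rank strictly between two
    consecutive ranks: its own gap being open, it cannot be an end of the
    interval. *)
Local Lemma spectrum_interval x i : (1 <= i <= n)%N ->
  x \in spectral_interval n zl zr a b i -> 0 < x /\ ~ rho x.
Proof.
move=> hi; have /andP[a0 _] := level_ends hi.
rewrite /spectral_interval itv_boundlr => /andP[lo up].
have x0 : 0 < x.
  by move: lo; case: ifPn => _; rewrite bnd_simp //; exact: lt_le_trans.
split=> // /lev_rho[d h]; have [j jn e] := levels_onto h.
have [x1 [x2 [/andP[h1 h2] C1 C2]]] := lev_open x0 h.
have [y [_ _ s1 s2]] := levels_sep hi.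
have : (i.-1 < j)%N.
  rewrite ltnNge; apply/negP => ji.
  move: lo; case: ifPn => hz; rewrite bnd_simp => lo.
    have [/eqP i1 /asboolP[d0 hd0]] := andP hz.
    have e0 := level_zero hd0; have j0 : j = 0%N by lia.
    have := lev0 hd0 (c := x%:E); rewrite e0 -j0 -e => /(_ h) [] x00.
    by rewrite x00 ltxx in x0.
  have [_ hsup] : a i <= y /\ has_sup (C (S i.-1)).
    by apply: level_sup_le => // z /s1; rewrite lte_fin.
  rewrite /a (negbTE hz) in lo.
  have ub z : C (S i.-1) z -> z <= x.
    by move=> Cz; apply: le_trans lo; exact: sup_upper_bound.
  move: ji; rewrite leq_eqVlt => /predU1P[ji|ji].
    have : x2 <= x by apply: ub; rewrite /C /= -ji -e.
    by rewrite leNgt h2.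
  have [z Cz] := hsup.1.
  have : (S i.-1 <= d)%N by apply: (lev_mono Cz h); rewrite lee_fin ub.
  by rewrite e leqNgt levels_lt//; lia.
have : (j < i)%N.
  rewrite ltnNge; apply/negP => ji.
  move: up; case: ifPn => hz; rewrite bnd_simp => up.
    have [/eqP i1 /asboolP[d0 hd0]] := andP hz.
    have e0 := level_infty hd0; have j0 : j = n by lia.
    by have := levy hd0 (c := x%:E); rewrite e0 -j0 -e => /(_ h).
  have [_ hinf] : y <= inf (C (S i)) /\ has_inf (C (S i)).
    by apply: level_inf_ge => // z /s2; rewrite lte_fin => /ltW.
  rewrite /b (negbTE hz) in up.
  have lb z : C (S i) z -> x <= z.
    by move=> Cz; apply: (le_trans up); exact: (ge_inf hinf.2 Cz).
  move: ji; rewrite leq_eqVlt => /predU1P[ji|ji].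
    have : x <= x1 by apply: lb; rewrite /C /= ji -e.
    by rewrite leNgt h1.
  have [z Cz] := hinf.1.
  have : (d <= S i)%N by apply: (lev_mono h Cz); rewrite lee_fin lb.
  by rewrite e leqNgt levels_lt.
by lia.
Qed.

Proposition level_decomposition :
  exists (n : nat) (s : nat -> nat) (a b : nat -> R),
  [/\ (n <= N)%N,
      spectral_form n zl zr a b [set x | 0 < x /\ ~ rho x],
      forall i, (i <= n)%N -> exists c, lev c (s i),
      forall i j, (i < j)%N -> (j <= n)%N -> (s i < s j)%N &
      (forall c d, lev c d -> exists2 i, (i <= n)%N & d = s i) /\
      (forall i x, (1 <= i < n)%N -> rho x -> b i < x < a i.+1 ->
         lev x%:E (s i))].
Proof.
exists n, S, a, b; split.
- exact: level_count.
- split; [exact: level_ends|exact: levels_order|].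
  apply/seteqP; split=> x /=.
    by move=> [x0 /(spectrum_covered x0)[i hi hx]]; exists i.
  by move=> [i /= hi hx]; exact: spectrum_interval hi hx.
- exact: levels_lev.
- exact: levels_lt.
- by split; [exact: levels_onto|exact: level_of_interior].
Qed.

End Levels.

(** * Bundles cut out by a flag of invariant projectors *)

Section Bundles.
Variables (R : realType) (N : nat) (A : int -> 'M[R]_N).
Hypothesis hA : forall k, A k \in unitmx.

Lemma range_bundle_invariant (E : int -> 'M[R]_N) : invariant_projector A E ->
  invariant_bundle A [set p | E p.1 *m p.2 = p.2].
Proof.
move=> hE; split.
- by exists (0, 0); rewrite /= mulmx0.
- move=> l x /= hx k.
  by rewrite mulmxA (invariant_projector_evol _ _ hA hE) -mulmxA hx.
- move=> l; exists (lker (linfun (mulmx (E l - 1%:M) : 'cV_N -> 'cV_N))).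
  apply/seteqP; split=> x; rewrite /fiber /= memv_ker lfunE /= mulmxBl mul1mx.
    by move=> ->; rewrite subrr.
  by rewrite subr_eq0 => /eqP.
Qed.

(** The evolution operators map fibers injectively into each other, in both
    directions of time. *)
Lemma invariant_bundle_dim W : invariant_bundle A W ->
  (exists p, W p /\ p.2 <> 0) -> exists2 d, bundle_dim W d & (1 <= d)%N.
Proof.
move=> [_ hinv /(@choice _ _)[V hV]] [[l0 x0] /= [Wx0 x00]].
have memV l x : W (l, x) <-> x \in V l by rewrite (_ : W (l, x) = fiber W l x) // hV.
have le l k : (\dim (V l) <= \dim (V k))%N.
  pose f := linfun (mulmx (evol A k l) : 'cV_N -> 'cV_N).
  have <- : \dim (f @: V l) = \dim (V l).
    apply: limg_dim_eq; apply/eqP; rewrite -subv0; apply/subvP => x.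
    rewrite memv_cap memv_ker lfunE /= memv0 => /andP[_ /eqP fx].
    by rewrite -[x]mul1mx -(evolK k l hA) -mulmxA fx mulmx0.
  apply: dimvS; apply/subvP => _ /memv_imgP[x /memV Wx ->].
  by rewrite lfunE /=; apply/memV; exact: hinv.
exists (\dim (V l0)).
  by move=> l; exists (V l); split; rewrite ?hV//; apply/eqP; rewrite eqn_leq !le.
rewrite lt0n dimv_eq0; apply/eqP => V0.
by apply: x00; apply/eqP; rewrite -memv0 -V0; exact/memV.
Qed.

Variables (m : nat) (F : nat -> int -> 'M[R]_N).
Hypothesis F_inv : forall i, invariant_projector A (F i).
Hypothesis F_le : forall i j l, (i <= j)%N -> proj_le (F i l) (F j l).
Hypothesis F_0 : F 0 = fun=> 0.
Hypothesis F_m : F m = fun=> 1%:M.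

(** The range of F i.+1 - F i (see [flag_bundleE]), written in the form in which
    spectral bundles are given: a kernel intersected with a range. *)
Definition flag_bundle i : set (int * 'cV[R]_N) :=
  [set p | F i p.1 *m p.2 = 0 /\ F i.+1 p.1 *m p.2 = p.2].

Lemma flag_bundleE i :
  flag_bundle i = [set p | (F i.+1 p.1 - F i p.1) *m p.2 = p.2].
Proof.
apply/seteqP; split=> -[l x] /=; rewrite /flag_bundle /=.
  by move=> [h1 h2]; rewrite mulmxBl h1 h2 subr0.
move=> h; have [h1 _] := F_le l (leqnSn i); have [FF _] := F_inv i.
have h0 : F i l *m x = 0 by rewrite -h mulmxA mulmxBr h1 FF subrr mul0mx.
by split=> //; move: h; rewrite mulmxBl h0 subr0.
Qed.

Lemma flag_projector i : invariant_projector A (fun l => F i.+1 l - F i l).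
Proof.
have [[FF1 FA1] [FF FA]] := (F_inv i.+1, F_inv i).
split=> k; last by rewrite mulmxBl mulmxBr FA1 FA.
have [h1 h2] := F_le k (leqnSn i).
by rewrite mulmxBl !mulmxBr FF1 FF h1 h2 subrr subr0.
Qed.

Lemma flag_bundle_invariant i : invariant_bundle A (flag_bundle i).
Proof. by rewrite flag_bundleE; apply: range_bundle_invariant (flag_projector i). Qed.

Lemma flag_bundle_dim i : F i 0%Z <> F i.+1 0%Z ->
  exists2 d, bundle_dim (flag_bundle i) d & (1 <= d)%N.
Proof.
move=> ne; apply: invariant_bundle_dim; first exact: flag_bundle_invariant.
apply: contrapT => h; apply: ne; apply: mulmx_cV_inj => x.
apply/eqP; rewrite eq_sym -subr_eq0 -mulmxBl; apply/eqP; apply: contrapT => hx.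
apply: h; exists (0%Z, (F i.+1 0%Z - F i 0%Z) *m x); split=> //.
by rewrite flag_bundleE /= mulmxA; case: (flag_projector i) => ->.
Qed.

Lemma flag_bundle_disjoint i j : i != j ->
  flag_bundle i `&` flag_bundle j = zero_bundle R N.
Proof.
wlog ij : i j / (i < j)%N.
  move=> H; rewrite neq_ltn => /orP[] ij; first by apply: H => //; rewrite neq_ltn ij.
  by rewrite setIC; apply: H => //; rewrite neq_ltn ij.
move=> _; apply/seteqP; split=> -[l x]; rewrite /flag_bundle /zero_bundle /=; last first.
  by move=> ->; rewrite !mulmx0.
move=> [[_ h1] [h2 _]]; have [_ h] := F_le l ij.
by rewrite -h1 -h -mulmxA h1 h2.
Qed.

Lemma flag_bundle_sum : bundle_sum m flag_bundle = setT.
Proof.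
apply/seteqP; split=> // -[l x] _; rewrite /bundle_sum /=.
exists (fun i => (F i.+1 l - F i l) *m x); split.
  move=> i _; rewrite flag_bundleE /= mulmxA.
  by case: (flag_projector i) => ->.
rewrite -mulmx_suml.
rewrite -(big_mkord xpredT (fun i => F i.+1 l - F i l)) telescope_sumr//.
by rewrite F_0 F_m subr0 mul1mx.
Qed.

End Bundles.

(** * The spectral theorem *)

Section Spectrum.
Variables (R : realType) (N : nat) (nrm : 'cV[R]_N -> R).
Hypothesis N0 : (0 < N)%N.
Hypothesis hnrm : is_norm nrm.
Variable A : int -> 'M[R]_N.
Hypothesis hA : forall k, A k \in unitmx.
Local Notation res := (ned_resolvent nrm A).
Local Notation gap := (gap nrm A).

Definition gap_level c d := exists2 P, gap c P & \rank (P 0%Z) = d.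

Lemma ned_spectrumE : ned_spectrum nrm A = [set x | 0 < x /\ ~ res x].
Proof.
apply/seteqP; split=> x /=; first by move=> h; split; [case: h|case].
by move=> [x0 h]; apply: contrapT => hx; apply: h.
Qed.

(** The rank of the projector at time 0 satisfies the hypotheses of
    [level_decomposition]. *)
Lemma spectral_levels :
  exists (n : nat) (zl zr : bool) (a b : nat -> R) (s : nat -> nat),
  [/\ (n <= N)%N,
      spectral_form n zl zr a b (ned_spectrum nrm A),
      forall i, (i <= n)%N -> exists c, gap_level c (s i),
      forall i j, (i < j)%N -> (j <= n)%N -> (s i < s j)%N &
      (forall c d, gap_level c d -> exists2 i, (i <= n)%N & d = s i) /\
      (forall i x, (1 <= i < n)%N -> res x -> b i < x < a i.+1 ->
         gap_level x%:E (s i))].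
Proof.
have [] := @level_decomposition R N res gap_level.
- by move=> c d [P _ <-]; exact: rank_leq_row.
- by have [c [P h]] := gap_exists N0 hnrm hA; exists c, (\rank (P 0%Z)), P.
- by move=> c d [P h _]; exact: gap_ge0 h.
- by move=> c d c' d' [P h <-] [P' h' <-] cc'; exact: (gap_rank_le hnrm hA cc' h h').
- move=> c c' d x [P h <-] [P' h' r].
  have e := gap_rank_inj hnrm hA h h' (esym r); rewrite -e in h'.
  by move=> cx; exact: (gap_between N0 hnrm hA cx h h').
- by move=> c d c' d' [P h <-] [P' h' <-]; exact: (gap_separated N0 hnrm hA h h').
- move=> x x0 hx; have [c [P [h cx]]] := gap_below N0 hnrm hA x0 hx.
  by exists c, (\rank (P 0%Z)); split=> //; exists P.
- move=> x x0 hx; have [c [P [h cx]]] := gap_above N0 hnrm hA x0 hx.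
  by exists c, (\rank (P 0%Z)); split=> //; exists P.
- move=> x /(ned_resolventP N0 hnrm hA)[P hP].
  by exists (\rank (P 0%Z)), P => //; constructor 1; exists x.
- move=> x d x0 [P /(gap_real x0) hP _].
  by apply/(ned_resolventP N0 hnrm hA); exists P.
- move=> x d x0 [P /(gap_real x0) hP <-].
  have [x1 [x2 [hx h1 h2]]] := dichotomy_open hP.
  by exists x1, x2; split=> //; exists P => //; constructor 1; [exists x1|exists x2].
- move=> c d [P h <-] [P' h' r]; exact: (gap0_isolated N0 hnrm hA h h' (esym r)).
- move=> c d [P h <-] [P' h' r]; exact: (gapy_isolated N0 hnrm hA h h' (esym r)).
move=> n [s [a [b [h1 h2 h3 h4 h5]]]].
rewrite ned_spectrumE; do 3 eexists; exists a, b, s.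
by split; [exact: h1|exact: h2|exact: h3|exact: h4|exact: h5].
Qed.

End Spectrum.

Theorem theorem2p6 (R : realType) (N : nat) (hN : (1 <= N)%N)
    (nrm : 'cV[R]_N -> R) (hnrm : is_norm nrm)
    (A : int -> 'M[R]_N) (hA : forall k, A k \in unitmx) :
  exists (n : nat) (zl zr : bool) (a b : nat -> R),
    [/\ (n <= N)%N,
        spectral_form n zl zr a b (ned_spectrum nrm A),
        forall g e : nat -> R, gap_choice nrm A n a b g e ->
          let W := spectral_bundle nrm A n g e in
          [/\ forall i, (i <= n.+1)%N -> invariant_bundle A (W i),
              forall i, (1 <= i <= n)%N ->
                exists2 d, bundle_dim (W i) d & (1 <= d)%N,
              forall i j, (i <= n.+1)%N -> (j <= n.+1)%N -> i != j ->
                W i `&` W j = zero_bundle R N &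
              bundle_sum n.+2 W = setT] &
        forall g e g' e' : nat -> R,
          gap_choice nrm A n a b g e -> gap_choice nrm A n a b g' e' ->
          forall i, (i <= n.+1)%N ->
            spectral_bundle nrm A n g e i = spectral_bundle nrm A n g' e' i].
Proof.
have [n [zl [zr [a [b [s [nN hform hlev slt [onto mid]]]]]]]] :=
  spectral_levels hN hnrm hA.
exists n, zl, zr, a, b.
have s_min d c : gap_level nrm A c d -> (s 0%N <= d)%N.
  by move=> /onto[[|i] iN ->] //; exact: ltnW (slt _ _ _ _).
have s_max d c : gap_level nrm A c d -> (d <= s n)%N.
  move=> /onto[i iN ->]; move: iN; rewrite leq_eqVlt => /predU1P[->//|iN].
  exact: ltnW (slt _ _ _ _).
(* By gap_rank_inj the projector depends on the rank alone. *)
have /choice[Pi hPi] : forall i, exists P, (i <= n)%N ->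
    (exists c, gap nrm A c P) /\ \rank (P 0%Z) = s i.
  move=> i; have [/hlev[c [P h r]]|//] := leqP i n; last by exists (fun=> 0).
  by exists P => _; split=> //; exists c.
have Pi_eq i c P : (i <= n)%N -> gap nrm A c P -> \rank (P 0%Z) = s i -> P = Pi i.
  move=> iN h r; have [[c' h'] r'] := hPi i iN.
  by apply: gap_rank_inj h h' _ => //; rewrite r r'.
(* The flag 0, Pi 0, ..., Pi n, Id; the spectral bundle of index i belongs to the
   step from F i to F i.+1. *)
pose F j := if j is i.+1 then if (i <= n)%N then Pi i else fun=> 1%:M
            else fun=> 0 : 'M[R]_N.
have Pi_inv i : (i <= n)%N -> invariant_projector A (Pi i).
  by move=> /hPi[[c /gap_proj]].
have F_inv j : invariant_projector A (F j).
  case: j => [|i] /=; first by split=> k; rewrite ?mul0mx ?mulmx0.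
  case: ifP => [/Pi_inv//|_].
  by split=> k; rewrite ?mul1mx ?mulmx1.
have F_le i j l : (i <= j)%N -> proj_le (F i l) (F j l).
  case: i j => [|i] [|j] //= ij; try by split; rewrite ?mul0mx ?mulmx0.
  have [jn|_] := leqP j n; last by split; rewrite ?mul1mx ?mulmx1.
  have iN : (i <= n)%N by exact: leq_trans jn.
  rewrite iN; have [[c h] r] := hPi i iN; have [[c' h'] r'] := hPi j jn.
  have [cc'|c'c] := leP c c'; first exact: (gap_le hnrm hA cc' h h').
  move: ij; rewrite ltnS leq_eqVlt => /predU1P[->|ij].
    by have [PP _] := Pi_inv j jn; split; exact: PP.
  have := gap_rank_le hnrm hA (ltW c'c) h' h.
  by rewrite r r' leqNgt slt.
have F_m : F n.+2 = fun=> 1%:M by rewrite /= ltnn.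
(* The chosen point at position i, genuine or virtual, has rank s i: at the ends
   because no spectral point lies beyond it, and inside by its position between
   two consecutive intervals.  Its projector is then Pi i. *)
have chosenE g e i : gap_choice nrm A n a b g e -> (i <= n)%N ->
    chosen_stable nrm A n g e i = [set p | Pi i p.1 *m p.2 = p.2] /\
    chosen_unstable nrm A n g e i = [set p | Pi i p.1 *m p.2 = 0].
  move=> [glow ghigh gmid] iN; rewrite /chosen_stable /chosen_unstable.
  case: ifPn => [/andP[/eqP i0 /asboolPn hl]|hl].
    have h : gap nrm A 0%E (fun=> 0) by constructor 2.
    have <- : (fun=> 0) = Pi i.
      apply: (Pi_eq _ _ _ iN h); rewrite mxrank0 i0; apply/eqP.
      rewrite eq_sym -leqn0; apply: (@s_min _ 0%E).
      by exists (fun=> 0) => //=; exact: mxrank0.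
    split; apply/seteqP; split=> p; rewrite /zero_bundle /= mul0mx //.
  case: ifPn => [/andP[/eqP i_n /asboolPn hh]|hh].
    have h : gap nrm A +oo%E (fun=> 1%:M) by constructor 3.
    have <- : (fun=> 1%:M) = Pi i.
      apply: (Pi_eq _ _ _ iN h); rewrite mxrank1 i_n; apply/eqP.
      rewrite eqn_leq (s_max _ +oo%E) /=; last by exists (fun=> 1%:M); rewrite ?mxrank1.
      by have [c [P _ <-]] := hlev n (leqnn n); exact: rank_leq_row.
    split; apply/seteqP; split=> p; rewrite /zero_bundle /= mul1mx //.
  have [gres hse glev] : [/\ ned_resolvent nrm A (g i),
      strong_NED nrm (weighted (g i) A) (e i) &
      forall P, gap nrm A (g i)%:E P -> \rank (P 0%Z) = s i].
    have [i0|i0] := eqVneq i 0%N.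
      rewrite {}i0 /= in hl hh iN *.
      have /glow[[hr hlow] hse] : exists x, low_gap nrm A x.
        by move: hl; rewrite negbK => /asboolP.
      split=> // P hP; apply/eqP; rewrite eq_sym eqn_leq.
      rewrite (s_min _ (g 0)%:E) /=; last by exists P.
      rewrite leqNgt; apply/negP => lt; have [c [Q hQ rQ]] := hlev 0%N (leq0n n).
      rewrite -rQ in lt.
      have [x [x0 hx /andP[_ xg]]] := gap_separated hN hnrm hA hQ hP lt.
      by apply: hx; apply: hlow; rewrite x0 -lte_fin.
    have [i_n|i_n] := eqVneq i n.
      rewrite {}i_n /= eqxx /= in i0 hh iN *.
      have /ghigh[[hr hhigh] hse] : exists x, high_gap nrm A x.
        by move: hh; rewrite negbK => /asboolP.
      split=> // P hP; apply/eqP; rewrite eqn_leq.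
      rewrite (s_max _ (g n)%:E) /=; last by exists P.
      rewrite leqNgt; apply/negP => lt; have [c [Q hQ rQ]] := hlev n (leqnn n).
      rewrite -rQ in lt.
      have [x [x0 hx /andP[xg _]]] := gap_separated hN hnrm hA hP hQ lt.
      by apply: hx; apply: hhigh; rewrite -lte_fin.
    have hi : (1 <= i < n)%N by lia.
    have [hr hg hse] := gmid i hi; split=> // P hP.
    have [Q hQ <-] := mid i (g i) hi hr hg.
    apply/eqP; rewrite eqn_leq (gap_rank_le hnrm hA (lexx _) hP hQ).
    exact: (gap_rank_le hnrm hA (lexx _) hQ hP).
  have /(ned_resolventP hN hnrm hA)[P hP] := gres.
  have hgap : gap nrm A (g i)%:E P by constructor 1; exists (g i).
  rewrite (strong_NED_eps1 hnrm hN hse) -(Pi_eq i _ P iN hgap (glev P hgap)).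
  by rewrite (stable_bundleE hnrm hA hP) (unstable_bundleE hnrm hA hP).
have WE g e i : gap_choice nrm A n a b g e -> (i <= n.+1)%N ->
    spectral_bundle nrm A n g e i = flag_bundle F i.
  move=> hg hi; rewrite /spectral_bundle /flag_bundle.
  case: i hi => [|i] hi /=.
    have [-> _] := chosenE g e 0%N hg (leq0n n).
    by apply/seteqP; split=> p /=; rewrite mul0mx; [|case].
  rewrite eqSS; have [->|i_n] := eqVneq i n.
    have [_ ->] := chosenE g e n hg (leqnn n).
    by rewrite leqnn ltnn; apply/seteqP; split=> p /=; rewrite mul1mx; [|case].
  have iN : (i < n)%N by lia.
  have [_ ->] := chosenE g e i hg (ltnW iN).
  by have [-> _] := chosenE g e i.+1 hg iN; rewrite (ltnW iN) iN.
split=> //; last by move=> g e g' e' hg hg' i hi; rewrite !WE.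
move=> g e hg W; have WF i : (i <= n.+1)%N -> W i = flag_bundle F i by exact: WE.
split.
- by move=> i hi; rewrite WF//; exact: flag_bundle_invariant.
- move=> i hi; rewrite WF; last by lia.
  apply: flag_bundle_dim => //; case: i hi => // i /= hi.
  have iN : (i < n)%N by lia.
  rewrite (ltnW iN) iN => e_i.
  have := slt i i.+1 (ltnSn i) iN.
  have [_ <-] := hPi i (ltnW iN); have [_ <-] := hPi i.+1 iN.
  by rewrite e_i ltnn.
- by move=> i j hi hj ij; rewrite !WF//; apply: flag_bundle_disjoint.
- rewrite -(flag_bundle_sum F_inv F_le erefl F_m).
  apply/seteqP; split=> p [w [hw pE]]; exists w; split=> // i hi.
    by rewrite -WF//; exact: hw.
  by rewrite WF//; exact: hw.
Qed.
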